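(* Let $$\widetilde\gamma_\varepsilon=16\left(\widetilde\delta_P^{-1}\max\left(\frac{8L}{\varepsilon},1\right)^d\right)\frac{\Lambda_P^2}{\lambda_P^2}\,\frac{C_\Omega\left\lceil \frac{8L\,\mathrm{diam}(\Omega)}{\varepsilon}\right\rceil^{d+2}}{q_0},\qquad q_0=\inf_{y\in\Omega'}Q\bigl(B_{\varepsilon/(8L)}(y)\bigr).$$ Then for all $(f,g)\in L^\infty(\Omega)\times L^\infty(\Omega')$, writing $M_{f,g}:=\max\left(\|f\oplus g-f_*\oplus g_*\|_{\infty},\varepsilon\right)$: (1) (for $\Phi$) $$\|f\oplus g-f_*\oplus g_*\|_{L^2(P\otimes Q)} \leq \widetilde\gamma_\varepsilon\, M_{f,g}\,\|\mathrm{D}\Phi(f \oplus g)\|_{L^2(P\otimes Q)},$$ $$\|\mathrm{D}\Phi(f \oplus g)\|_{L^2(P\otimes Q)}^2 \geq \frac{1}{\widetilde\gamma_\varepsilon M_{f,g}} \big(\mathrm{QOT}_\varepsilon(P,Q)- \Phi(f \oplus g) \big);$$ (2) (for $\Gamma$) $$\|f\oplus g-f_*\oplus g_*\|_{L^2(P\otimes Q)} \leq \widetilde\gamma_{\varepsilon}\,M_{f,g}\,\|\mathrm{D}\Gamma(f,g)\|_{L^2(P)\times L^2(Q)},$$ $$\|\mathrm{D}\Gamma (f,g)\|_{L^{2}(P) \times L^{2}(Q)}^{2} \geq \frac{1}{\widetilde\gamma_\varepsilon M_{f,g}}\big(\mathrm{QOT}_\varepsilon(P,Q)- \Gamma (f,g)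 \big).$$
   Context: Fix $d\ge 1$ and $\varepsilon>0$. $B_r(x)\subset\mathbb{R}^d$ is the open ball of center $x$ and radius $r>0$. $P$ and $Q$ are probability measures on $\mathbb{R}^d$ such that: $P$ has support $\Omega=\overline U$, where $U\subset\mathbb{R}^d$ is a bounded connected Lipschitz domain, and a density $\rho=dP/d\mathcal{L}_d$ with respect to Lebesgue measure $\mathcal{L}_d$ with $\lambda_P\le\rho(x)\le\Lambda_P$ for all $x\in\Omega$, for constants $0<\lambda_P<\Lambda_P<\infty$; $Q$ has compact support $\Omega'$. The cost $c:\mathbb{R}^d\times\mathbb{R}^d\to\mathbb{R}$ is Lipschitz with constant $L>0$. Geometric constants, depending only on $\Omega$: $\delta_\Omega\in(0,1]$ is a constant such that $|B_r(x)\cap\Omega|\ge\delta_\Omega r^d$ for all $x\in\Omega$, $0<r\le\mathrm{diam}(\Omega)$ (it exists), and $\widetilde\delta_P:=\min(1,\lambda_P\delta_\Omega)$. $C_\Omega\ge1$ is a constant (it exists) such that for every $\varrho>0$ and $h\in L^2(\Omega)$ (Lebesgue measure), $$\int_\Omega\int_\Omega (h(x)-h(z))^2\,dz\,dx\le C_\Omega\left\lceil \frac{\mathrm{diam}(\Omega)}{\varrho}\right\rceil^{d+2}\int_\Omega\int_{B_\varrho(x)\cap\Omega} (h(x)-h(z))^2\,dz\,dx .$$ With $\Pi(P,Q)$ the set of couplings of $(P,Q)$, $$\mathrm{QOT}_\varepsilon(P,Q):=\inf_{\pi\in\Pi(P,Q)}\int c\,d\pi+\frac{\varepsilon}{2}\left\|\frac{d\pi}{d(P\otimes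 Q)}\right\|^2_{L^2(P\otimes Q)},$$ the last term being $+\infty$ if $\pi\not\ll P\otimes Q$. The dual objective $\Gamma:L^2(P)\times L^2(Q)\to\mathbb{R}$ is $$\Gamma(f,g):=\int\Big(f(x)+g(y)-\frac{1}{2\varepsilon}\big(f(x)+g(y)-c(x,y)\big)_+^2\Big)\,d(P\otimes Q)(x,y),$$ where $(t)_+=\max(t,0)$. Its gradient is $\mathrm{D}\Gamma(f,g)=(\mathrm{D}_1\Gamma(f,g),\mathrm{D}_2\Gamma(f,g))\in L^2(P)\times L^2(Q)$ with $$\mathrm{D}_1\Gamma(f,g)(x)=1-\frac1\varepsilon\int (f(x)+g(y)-c(x,y))_+\,dQ(y),\qquad \mathrm{D}_2\Gamma(f,g)(y)=1-\frac1\varepsilon\int (f(x)+g(y)-c(x,y))_+\,dP(x).$$ The norm on the product is $\|(u,v)\|^2_{L^2(P)\times L^2(Q)}=\|u\|^2_{L^2(P)}+\|v\|^2_{L^2(Q)}$. Write $(f\oplus g)(x,y):=f(x)+g(y)$. Let $\mathcal{H}=\{u\oplus v:(u,v)\in L^2(P)\times L^2(Q)\}$, a closed subspace of $L^2(P\otimes Q)$ and hence a Hilbert space with the induced inner product. $\Phi:\mathcal{H}\to\mathbb{R}$ is defined by $\Phi(f\oplus g)=\Gamma(f,g)$ and $\mathrm{D}\Phi(f\oplus g)\in\mathcal{H}$ denotes its $\mathcal{H}$-gradient. Known facts: strong duality $\mathrm{QOT}_\varepsilon(P,Q)=\sup_{L^2(P)\times L^2(Q)}\Gamma$ holds; maximizers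 of $\Gamma$ exist and are unique up to $(f_*+a,g_*-a)$, $a\in\mathbb{R}$. The potentials $(f_*,g_* )$ are a fixed (arbitrary) maximizer, with versions $f_*:\Omega\to\mathbb{R}$, $g_*:\Omega'\to\mathbb{R}$ that are $L$-Lipschitz; they satisfy $\int (f_*(x)+g_*(y)-c(x,y))_+dQ(y)=\varepsilon$ for all $x\in\Omega$ and $\int (f_*(x)+g_*(y)-c(x,y))_+dP(x)=\varepsilon$ for all $y\in\Omega'$. $L^\infty(\Omega)$, $L^\infty(\Omega')$ in the claim are the spaces of bounded measurable functions, and $\|\cdot\|_\infty$ is the sup norm. *)

(* Defs.v *)
From HB Require Import structures.
From mathcomp Require Import all_boot all_order all_algebra.
From mathcomp Require Import all_classical all_reals all_analysis measurable_realfun.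
Set Implicit Arguments.
Unset Strict Implicit.
Unset Printing Implicit Defensive.
Import Order.TTheory GRing.Theory Num.Theory.
Import numFieldTopology.Exports numFieldNormedType.Exports.
Local Open Scope classical_set_scope.
Local Open Scope ring_scope.

Section matrix_borel.
Context {R : realType} {m n : nat}.

HB.instance Definition _ :=
  @isMeasurable.Build (sigma_display (@open 'M[R]_(m, n))) 'M[R]_(m, n)
    <<s @open 'M[R]_(m, n) >> (@sigma_algebra0 _ setT _)
    (@sigma_algebraC _ (@open 'M[R]_(m, n)))
    (@sigma_algebra_bigcup _ setT _).

Lemma open_measurable_mx (A : set 'M[R]_(m, n)) : open A -> measurable A.
Proof. by move=> oA; exact: sub_sigma_algebra. Qed.

Lemma measurable_coord_mx i j :
  measurable_fun setT (fun A : 'M[R]_(m, n) => A i j).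
Proof.
apply: (measurability _ (RGenOpens.measurableE R)) => _ [_ [x [y ->] <-]].
rewrite setTI; apply: open_measurable_mx.
apply: open_comp; first by move=> A _; exact: coord_continuous.
exact: interval_open.
Qed.

Lemma measurable_fun_mxP d (T : measurableType d) (D : set T)
    (f : T -> 'M[R]_(m, n)) : measurable D ->
  (forall i j, measurable_fun D (fun t => f t i j)) -> measurable_fun D f.
Proof.
move=> mD mf.
apply: (@measurability _ _ _ _ D f (@open 'M[R]_(m, n)) erefl).
move=> _ [V oV <-].
pose B (q : 'M[rat]_(m, n) * nat) : set 'M[R]_(m, n) :=
  [set A | forall i j, ball (ratr (q.1 i j) : R) q.2.+1%:R^-1 (A i j)].
have -> : V = \bigcup_(q in [set q | B q `<=` V]) B q.
  apply/seteqP; split=> [A VA|A [q qV /qV //]].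
  have /nbhs_ballP[e /= e0 eV] : nbhs A V by exact: open_nbhs_nbhs.
  have [k ke] : exists k : nat, k.+1%:R^-1 < e / 2.
    exists (Num.truncn (e / 2)^-1).
    rewrite invf_plt ?posrE ?divr_gt0//; exact: truncnS_gt.
  have q_ex i j : exists q : rat, `|A i j - ratr q| < k.+1%:R^-1.
    have k0 : 0 < k.+1%:R^-1 :> R by rewrite invr_gt0.
    have /rat_in_itvoo[q] : A i j - k.+1%:R^-1 < A i j + k.+1%:R^-1.
      by rewrite ltrD2l gtrN.
    rewrite in_itv/= => /andP[q1 q2]; exists q.
    by rewrite ltr_distlC q1.
  pose q := \matrix_(i, j) xget 0 [set q : rat | `|A i j - ratr q| < k.+1%:R^-1].
  have qA i j : `|A i j - ratr (q i j)| < k.+1%:R^-1.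
    by rewrite mxE; exact: (xgetPex 0 (q_ex i j)).
  exists (q, k); last first.
    by move=> i j; rewrite /ball/= distrC; exact: qA.
  move=> C BC; apply: eV; split => // i j.
  rewrite /ball/=; have := BC i j; rewrite /ball/= => h.
  apply: (@le_lt_trans _ _ (`|A i j - ratr (q i j)| + `|ratr (q i j) - C i j|)).
    exact: ler_distD.
  by rewrite (splitr e) ltrD// (lt_trans _ ke).
rewrite preimage_bigcup setI_bigcupr bigcup_mkcond.
apply: countable_bigcupT_measurable => [|q]; first exact: countableP.
case: ifPn => _ //.
have -> : D `&` f @^-1` B q = D `&`
    \bigcap_(i in [set: 'I_m * 'I_n])
      (D `&` [set t | ball (ratr (q.1 i.1 i.2) : R) q.2.+1%:R^-1 (f t i.1 i.2)]).
  apply/seteqP; split=> t /=.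
    by move=> [Dt h]; split => // -[i j] _; split => //; exact: h.
  by move=> [Dt h]; split => // i j; have [] := h (i, j) I.
apply: measurableI => //; apply: fin_bigcap_measurable => // -[i j] _ /=.
exact: (mf i j mD _ (measurable_ball _ _)).
Qed.

End matrix_borel.

Section lebesgue_measure_rV.
Context {R : realType}.
Local Open Scope ereal_scope.

Section step.
Context {d : nat} (mu : {sigma_finite_measure set 'rV[R]_d -> \bar R}).

Definition cons_rV (p : measurableTypeR R * 'rV[R]_d) : 'rV[R]_d.+1 :=
  row_mx (p.1%:M : 'rV[R]_1) p.2.

Definition lebesgue_step : set 'rV[R]_d.+1 -> \bar R :=
  pushforward (@lebesgue_measure R \x mu) cons_rV.

Lemma cons_rV0 p : cons_rV p ord0 ord0 = p.1.
Proof.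
by rewrite /cons_rV mxE; case: (split_ordP (m := 1) _) => k // _;
  rewrite mxE !ord1 eqxx mulr1n.
Qed.

Lemma cons_rVS p i : cons_rV p ord0 (lift ord0 i) = p.2 ord0 i.
Proof.
rewrite /cons_rV (_ : lift ord0 i = rshift 1 i); last exact/val_inj.
exact: row_mxEr.
Qed.

Lemma measurable_cons_rV : measurable_fun setT cons_rV.
Proof.
apply: measurable_fun_mxP => // i j.
rewrite /cons_rV; under eq_fun do rewrite mxE.
case: (split_ordP (m := 1) j) => k _.
  under eq_fun do rewrite mxE !ord1 eqxx mulr1n.
  exact: measurable_fst.
exact: (measurableT_comp (measurable_coord_mx i k) measurable_snd).
Qed.


Let step_measure : {measure set 'rV[R]_d.+1 -> \bar R} :=
  measure_function_pushforward__canonical__measure_function_Measure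
    (lebesgue_measure \x mu) measurable_cons_rV.

Let step0 : lebesgue_step set0 = 0.
Proof. exact: (measure0 step_measure). Qed.

Let step_ge0 A : 0 <= lebesgue_step A.
Proof. exact: (measure_ge0 step_measure). Qed.

Let step_sigma_additive : semi_sigma_additive lebesgue_step.
Proof. exact: (@measure_semi_sigma_additive _ _ _ step_measure). Qed.

HB.instance Definition _ := isMeasure.Build _ _ _ lebesgue_step
  step0 step_ge0 step_sigma_additive.

Let uncons (x : 'rV[R]_d.+1) : measurableTypeR R * 'rV[R]_d :=
  (x ord0 ord0, rsubmx (x : 'rV_(1 + d))).

Let cons_rVK : cancel cons_rV uncons.
Proof.
move=> [a v]; congr (_, _); last by rewrite /= /cons_rV row_mxKr.
exact: cons_rV0.
Qed.

Let measurable_uncons : measurable_fun setT uncons.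
Proof.
apply/measurable_fun_pairP; split; first exact: measurable_coord_mx.
apply: measurable_fun_mxP => // i j.
under eq_fun do rewrite mxE.
exact: measurable_coord_mx.
Qed.

(* Not inferred: the canonical sigma-finite structure of [m1 \x m2] found by
   unification is the one for finite [m1] and [m2]. *)
Let step_sigma_finite : sigma_finite setT lebesgue_step.
Proof.
have /sigma_finiteP[F [FT ndF Foo]] := sigma_finiteT (@lebesgue_measure R).
have /sigma_finiteP[G [GT ndG Goo]] := sigma_finiteT mu.
exists (fun k => uncons @^-1` (F k `*` G k)) => [|k].
  rewrite -preimage_bigcup (_ : \bigcup_k _ = setT) ?preimage_setT//.
  apply/seteqP; split=> // -[a v] _.
  have [n _ Fna] : (\bigcup_n F n) a by rewrite -FT.
  have [k _ Gkv] : (\bigcup_n G n) v by rewrite -GT.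
  exists (maxn n k) => //; split => /=.
  - by move: a Fna; exact/subsetPset/ndF/leq_maxl.
  - by move: v Gkv; exact/subsetPset/ndG/leq_maxr.
have [mF Fk] := Foo k; have [mG Gk] := Goo k; split.
  rewrite -[X in measurable X]setTI; apply: measurable_uncons => //.
  exact: measurableX.
rewrite /lebesgue_step /pushforward -comp_preimage.
rewrite (_ : uncons \o cons_rV = id); last first.
  by apply/funext => p /=; rewrite cons_rVK.
by rewrite preimage_id product_measure1E// lte_mul_pinfty// ge0_fin_numE.
Qed.

HB.instance Definition _ := @Measure_isSigmaFinite.Build _ _ _ lebesgue_step
  step_sigma_finite.

End step.

(* Lebesgue measure on ['rV[R]_d], as the iterated product of the Lebesgue
   measure on [R] transported by [cons_rV]; [lebesgue_rV_box] below is its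
   characterization on boxes. *)
Fixpoint lebesgue_rV (d : nat) : {sigma_finite_measure set 'rV[R]_d -> \bar R} :=
  match d with
  | 0 => [the {sigma_finite_measure set 'rV[R]_0 -> \bar R} of \d_(0%R : 'rV[R]_0)]
  | d'.+1 => [the {sigma_finite_measure set 'rV[R]_d'.+1 -> \bar R} of
               lebesgue_step (lebesgue_rV d')]
  end.

Lemma lebesgue_rV_box d (A : 'I_d -> set (measurableTypeR R)) :
    (forall i, measurable (A i)) ->
  lebesgue_rV d [set x | forall i, A i (x ord0 i)] =
    \prod_(i < d) lebesgue_measure (A i).
Proof.
elim: d A => [|d IH] A mA.
  by rewrite big_ord0 /= diracE mem_set// => -[].
have mB : measurable
    [set v : 'rV[R]_d | forall i, A (lift ord0 i) (v ord0 i)].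
  rewrite [X in measurable X](_ : _ = \bigcap_(i in [set: 'I_d])
    ((fun v : 'rV[R]_d => v ord0 i) @^-1` A (lift ord0 i))); last first.
    by apply/seteqP; split => v /= h i; [move=> _|]; exact: h.
  apply: fin_bigcap_measurable => // i _.
  by rewrite -[X in measurable X]setTI; apply: (measurable_coord_mx ord0 i measurableT); exact: mA.
rewrite big_ord_recl -IH; last by move=> i; exact: mA.
rewrite -product_measure1E//=.
rewrite /lebesgue_step /pushforward; congr (product_measure1 _ _ _).
apply/seteqP; split => -[a v] /=.
  move=> h; split => [|i]; first by have := h ord0; rewrite cons_rV0.
  by have := h (lift ord0 i); rewrite cons_rVS.
move=> [Aa Av] i; case: (unliftP ord0 i) => [k|] ->; last by rewrite cons_rV0.
by rewrite cons_rVS.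
Qed.

End lebesgue_measure_rV.
Arguments lebesgue_rV : clear implicits.

(* The library norm of ['rV[R]_n] is the sup norm, which induces the same
   topology and the same bounded sets; every metric quantity below (balls,
   diameter, Lipschitz constants) is Euclidean. *)
Section euclidean_geometry.
Context {R : realType} {n : nat}.
Implicit Types (x y p : 'rV[R]_n) (A U : set 'rV[R]_n).

Definition enorm x : R := Num.sqrt (\sum_(i < n) x ord0 i ^+ 2).

Definition eball x (r : R) : set 'rV[R]_n := [set y | enorm (y - x) < r].

Definition ediam A : R :=
  sup [set enorm (z.1 - z.2) | z in A `*` A].

Definition elipschitz_on (K : R) A (f : 'rV[R]_n -> R) : Prop :=
  forall x y, A x -> A y -> `|f x - f y| <= K * enorm (x - y).

End euclidean_geometry.

(* [x *m O] are the coordinates of [x] in a rotated orthonormal frame, the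
   [i]-th of which is the vertical one: near [p], [U] is the strict epigraph
   of [phi]. *)
Definition lipschitz_boundary {R : realType} {n : nat} (U : set 'rV[R]_n) :=
  forall p, (closure U `\` U) p ->
  exists (r K : R) (O : 'M[R]_n) (i : 'I_n) (phi : 'rV[R]_n.-1 -> R),
    [/\ 0 < r, O *m O^T = 1%:M, elipschitz_on K setT phi &
        forall x, eball p r x ->
          U x <-> phi (col' i (x *m O)) < (x *m O) ord0 i].

Definition bounded_lipschitz_domain {R : realType} {n : nat}
    (U : set 'rV[R]_n) :=
  [/\ open U, U !=set0, connected U, bounded_set U & lipschitz_boundary U].

Definition msupport {R : realType} {n : nat} (mu : set 'rV[R]_n -> \bar R) :
    set 'rV[R]_n :=
  [set x | forall V, open V -> V x -> (0 < mu V)%E].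

Section domain_constants.
Context {R : realType} {d : nat}.
Local Open Scope ereal_scope.

Definition density_constant (Omega : set 'rV[R]_d) (delta : R) : Prop :=
  (0 < delta <= 1)%R /\
  forall x r, Omega x -> (0 < r <= ediam Omega)%R ->
    (delta * r ^+ d)%:E <= lebesgue_rV R d (eball x r `&` Omega).

Definition nonlocal_poincare_constant (Omega : set 'rV[R]_d) (C : R) : Prop :=
  (1 <= C)%R /\
  forall (r : R) (h : 'rV[R]_d -> R), (0 < r)%R ->
    measurable_fun Omega h ->
    \int[lebesgue_rV R d]_(x in Omega) (h x ^+ 2)%:E < +oo ->
    \int[lebesgue_rV R d]_(x in Omega)
      \int[lebesgue_rV R d]_(z in Omega) ((h x - h z) ^+ 2)%:E <=
    (C * (Num.ceil (ediam Omega / r))%:~R ^+ (d + 2))%:E *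
    \int[lebesgue_rV R d]_(x in Omega)
      \int[lebesgue_rV R d]_(z in eball x r `&` Omega) ((h x - h z) ^+ 2)%:E.

Definition has_lebesgue_density (P : set 'rV[R]_d -> \bar R)
    (rho : 'rV[R]_d -> R) : Prop :=
  [/\ measurable_fun setT rho, forall x, (0 <= rho x)%R &
      forall A, measurable A -> P A = \int[lebesgue_rV R d]_(x in A) (rho x)%:E].

End domain_constants.

Definition oplus {R : realType} {X Y : Type} (f : X -> R) (g : Y -> R) :
  X * Y -> R := fun z => f z.1 + g z.2.

Definition L2norm {R : realType} {disp} {T : measurableType disp}
  (mu : {measure set T -> \bar R}) (h : T -> R) : \bar R :=
  'N[mu]_2%:E [EFin \o h]%E.

Definition supnorm_on {R : realType} {T : Type} (A : set T) (h : T -> R) : R :=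
  sup [set `|h z| | z in A].

(* An element of [L^oo(A)] is represented by a function on the whole space
   whose values off [A] are irrelevant; every measurable function on a
   measurable [A] has such an extension. *)
Definition Linfty_on {R : realType} {n : nat} (A : set 'rV[R]_n)
    (f : 'rV[R]_n -> R) : Prop :=
  measurable_fun setT f /\ exists K : R, forall x, A x -> `|f x| <= K.

Local Open Scope charge_scope.

Section quadratic_optimal_transport.
Context {R : realType} {d : nat}.
Local Notation Rd := ('rV[R]_d).
Variables (P Q : probability Rd R) (c : Rd * Rd -> R) (eps : R).

(* Bundled, because [Radon_Nikodym] takes a sigma-finite measure. *)
Local Notation PxQ := ((P \x Q)%E : probability (Rd * Rd)%type R).

Definition coupling (pi : probability (Rd * Rd)%type R) : Prop :=
  (forall A, measurable A -> pi (fst @^-1` A) = P A) /\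
  (forall B, measurable B -> pi (snd @^-1` B) = Q B).

(* The squared [L^2(P \x Q)]-norm of the density of [pi], [+oo] when there is
   none. *)
Definition density_sqnorm (pi : probability (Rd * Rd)%type R) : \bar R :=
  (if `[< pi `<< PxQ >]
   then 'N[PxQ]_2%:E ['d (charge_of_finite_measure pi) '/d PxQ] ^+ 2
   else +oo)%E.

Definition QOT : \bar R :=
  ereal_inf [set (\int[pi]_z (c z)%:E + (eps / 2)%:E * density_sqnorm pi)%E |
             pi in coupling].

Definition Gamma (f g : Rd -> R) : R :=
  \int[(P \x Q)%E]_z
    (f z.1 + g z.2 - (2 * eps)^-1 * Num.max (f z.1 + g z.2 - c z) 0 ^+ 2).

Definition D1Gamma (f g : Rd -> R) : Rd -> R :=
  fun x => 1 - eps^-1 * \int[Q]_y Num.max (f x + g y - c (x, y)) 0.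

Definition D2Gamma (f g : Rd -> R) : Rd -> R :=
  fun y => 1 - eps^-1 * \int[P]_x Num.max (f x + g y - c (x, y)) 0.

Definition DGamma_norm (f g : Rd -> R) : \bar R :=
  sqrte (L2norm P (D1Gamma f g) ^+ 2 + L2norm Q (D2Gamma f g) ^+ 2)%E.

Definition Hspace : set (Rd * Rd -> R) :=
  [set h | exists u v : Rd -> R,
    [/\ u \in Lfun P 2%:E, v \in Lfun Q 2%:E & h = oplus u v]].

Definition Phi (h : Rd * Rd -> R) : R :=
  \int[(P \x Q)%E]_z (h z - (2 * eps)^-1 * Num.max (h z - c z) 0 ^+ 2).

Lemma Phi_oplus f g : Phi (oplus f g) = Gamma f g.
Proof. by []. Qed.

(* [w] is the gradient of [Phi] at [h] in the Hilbert space [Hspace], for the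
   inner product of [L^2(P \x Q)]. *)
Definition is_Hgradient (h w : Rd * Rd -> R) : Prop :=
  Hspace w /\
  forall eta : R, 0 < eta -> exists2 r : R, 0 < r &
    forall k, Hspace k -> (L2norm (P \x Q)%E k <= r%:E)%E ->
      (`|Phi (h \+ k) - Phi h - \int[(P \x Q)%E]_z (w z * k z)|%:E
         <= eta%:E * L2norm (P \x Q)%E k)%E.

(* The gradient is unique up to [P \x Q]-null sets, so that its norm does not
   depend on the choice; the default value [cst 0] would only be taken if
   [Phi] were not differentiable at [h]. *)
Definition DPhi (h : Rd * Rd -> R) : Rd * Rd -> R :=
  xget (cst 0) [set w | is_Hgradient h w].

Definition maximizer (f g : Rd -> R) : Prop :=
  [/\ f \in Lfun P 2%:E, g \in Lfun Q 2%:E &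
      forall u v, u \in Lfun P 2%:E -> v \in Lfun Q 2%:E ->
        Gamma u v <= Gamma f g].

End quadratic_optimal_transport.

Definition gamma_tilde {R : realType} {d : nat} (eps L lamP LamP delta C : R)
    (Q : set 'rV[R]_d -> \bar R) (Omega Omega' : set 'rV[R]_d) : R :=
  let deltaP := Num.min 1 (lamP * delta) in
  let q0 := inf [set fine (Q (eball y (eps / (8 * L)))) | y in Omega'] in
  16 * (deltaP^-1 * Num.max (8 * L / eps) 1 ^+ d) * (LamP ^+ 2 / lamP ^+ 2) *
  (C * (Num.ceil (8 * L * ediam Omega / eps))%:~R ^+ (d + 2) / q0).

(* Main.v *)
Require Import Defs.
From HB Require Import structures.
From mathcomp Require Import all_boot all_order all_algebra.
From mathcomp Require Import all_classical all_reals all_analysis measurable_realfun.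
From mathcomp Require Import ring lra.

(** Write [w = (f - fs) (+) (g - gs)], [h = f (+) g], [hs = fs (+) gs].

    Everything reduces to the lower bound
    [|w|^2 <= gam * M * - <D Phi(h), w>]. Given it, Cauchy-Schwarz yields the error
    bound, and concavity of [Phi] together with [QOT <= Gamma(fs, gs)] yields
    [QOT - Phi(h) <= - <D Phi(h), w> <= gam * M * |D Phi(h)|^2]
    ([gradient_dominance]). The H-gradient of [Phi] is the orthogonal projection
    [D1 (+) (D2 - m)] of [1 - (h - c)_+ / eps], where [m] is the common mean of the
    partial gradients; its squared norm is [|D1|^2 + |D2|^2 - m^2], so the
    inequalities for [Gamma] follow from those for [Phi]. The bound
    [QOT <= Gamma(fs, gs)] comes from the plan with density [(hs - c)_+ / eps]
    ([QOT_le_Gamma]).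

    By optimality of [(fs, gs)], [- <D Phi(h), w>] is the integral of
    [((h - c)_+ - (hs - c)_+) w / eps]. On the set [S] where [hs - c >= eps / 2] the
    integrand is at least [w^2 / (2 M)], and it is nonnegative elsewhere
    ([pos_part_coercive]). It remains to control [|w|^2] by the integral of [w^2]
    over [S] ([coercivity]). For each [x] the mean over [y] of [(hs - c)_+] is
    [eps], so that [hs - c] is nearly [eps] at some [(x, y)]; being Lipschitz, it is
    at least [eps / 2] on a product of balls of radius [r = eps / (8 L)] around it
    ([contact_point], [contact_transport]). Hence for [|x - z| < r] the increment
    [u x - u z] is a difference of two values of [w] on [S], for a set of [y] of
    mass at least [q0]; the nonlocal Poincare inequality then bounds the variance
    of [u]. Exchanging the roles of [x] and [y] bounds the remaining part, a
    function of [y] alone. *)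

Set Implicit Arguments.
Unset Strict Implicit.
Unset Printing Implicit Defensive.
Import Order.TTheory GRing.Theory Num.Theory.
Import numFieldTopology.Exports numFieldNormedType.Exports.
Local Open Scope classical_set_scope.
Local Open Scope ring_scope.

(** * Real-valued integrals and square-integrable functions *)

Section real_integral.
Context {R : realType} {disp} {T : measurableType disp}.
Variable mu : {measure set T -> \bar R}.
Implicit Types f g : T -> R.
Local Notation rintegrable f := (mu.-integrable setT (EFin \o f)).

Lemma rintegrableD f g : rintegrable f -> rintegrable g ->
  rintegrable (fun x => f x + g x).
Proof. by move=> fi gi; have := integrableD measurableT fi gi. Qed.

Lemma rintegrableB f g : rintegrable f -> rintegrable g ->
  rintegrable (fun x => f x - g x).
Proof. by move=> fi gi; have := integrableB measurableT fi gi. Qed.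

Lemma rintegrableZ (k : R) f : rintegrable f -> rintegrable (fun x => k * f x).
Proof. by move=> fi; have := integrableZl measurableT k fi. Qed.

Lemma rintegral_measurable f : rintegrable f -> measurable_fun setT f.
Proof. by move=> /integrableP[/measurable_EFinP]. Qed.

Lemma EFin_Rintegral f : rintegrable f ->
  (\int[mu]_x f x)%:E = (\int[mu]_x (f x)%:E)%E.
Proof. by move=> fi; rewrite /Rintegral fineK//; exact: integrable_fin_num. Qed.

Lemma ae_eq_Rintegral f g : measurable_fun setT f -> measurable_fun setT g ->
  {ae mu, forall x, f x = g x} -> \int[mu]_x f x = \int[mu]_x g x.
Proof.
move=> mf mg fg; congr fine; apply: ae_eq_integral => //;
  [exact/measurable_EFinP|exact/measurable_EFinP|].
by apply: filterS fg => x -> .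
Qed.

Lemma ae_le_Rintegral f g : rintegrable f -> rintegrable g ->
  {ae mu, forall x, f x <= g x} -> \int[mu]_x f x <= \int[mu]_x g x.
Proof.
move=> fi gi fg; rewrite -subr_ge0 -RintegralB//.
have mf := rintegral_measurable fi; have mg := rintegral_measurable gi.
rewrite (@ae_eq_Rintegral _ (fun x => `|g x - f x|)).
- by apply: Rintegral_ge0.
- exact: measurable_funB.
- by apply: measurableT_comp => //; exact: measurable_funB.
- by apply: filterS fg => x fgx; rewrite ger0_norm// subr_ge0.
Qed.

End real_integral.

Section square_integrable.
Context {R : realType} {disp} {T : measurableType disp}.
Variable mu : probability T R.
Implicit Types f g h : T -> R.
Local Notation L2 := (Lfun mu 2%:E).
Local Notation rintegrable f := (mu.-integrable setT (EFin \o f)).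

Lemma Lfun2_measurable f : f \in L2 -> measurable_fun setT f.
Proof. by rewrite inE => /andP[+ _]; rewrite inE. Qed.

Lemma L2norm_sqr f : (L2norm mu f ^+ 2 = \int[mu]_x (f x ^+ 2)%:E)%E.
Proof.
have -> : (L2norm mu f ^+ 2 = L2norm mu f `^ 2)%E.
  have := Lnorm_ge0 mu 2%:E (EFin \o f); rewrite -/(L2norm mu f).
  case: (L2norm mu f) => [r| |]//; last by rewrite poweRyr// expe2 mulyy.
  by rewrite lee_fin => r0; rewrite poweR_EFin powR_mulrn// EFin_expe.
rewrite poweR_Lnorm//.
apply: eq_integral => x _ /=.
by rewrite powR_mulrn// -normrX ger0_norm ?sqr_ge0.
Qed.

Lemma Lfun2P f : measurable_fun setT f ->
  (\int[mu]_x (f x ^+ 2)%:E < +oo)%E -> f \in L2.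
Proof.
move=> mf; rewrite -L2norm_sqr => foo.
rewrite inE; apply/andP; rewrite !inE/=; split => //.
rewrite /finite_norm ltey; apply/eqP => foo'.
by move: foo; rewrite /L2norm foo'/=.
Qed.

Lemma Lfun2_mul_integrable f g : f \in L2 -> g \in L2 ->
  rintegrable (fun x => f x * g x).
Proof. by move=> fL gL; apply/Lfun1_integrable/Lfun2_mul_Lfun1. Qed.

Lemma Lfun2_cst (k : R) : (fun=> k) \in L2.
Proof. exact: Lfun_cst. Qed.

Lemma Lfun2_integrable f : f \in L2 -> rintegrable f.
Proof.
move=> fL; have := Lfun2_mul_integrable fL (Lfun2_cst 1).
by under eq_fun do rewrite mulr1.
Qed.

Lemma Lfun2D f g : f \in L2 -> g \in L2 -> (fun x => f x + g x) \in L2.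
Proof. by have [_ LD] := Lfun_addr_closed mu (lee1n 2); exact: LD. Qed.

Lemma Lfun2Z (k : R) f : f \in L2 -> (fun x => k * f x) \in L2.
Proof.
move=> fL; have := Lfun_scale k (ler1n R 2) fL.
by under eq_fun do rewrite /= mulrC.
Qed.

Lemma Lfun2N f : f \in L2 -> (fun x => - f x) \in L2.
Proof.
by move=> fL; have := Lfun2Z (-1) fL; under eq_fun do rewrite mulN1r.
Qed.

Lemma Lfun2B f g : f \in L2 -> g \in L2 -> (fun x => f x - g x) \in L2.
Proof. by move=> fL gL; apply: Lfun2D => //; exact: Lfun2N. Qed.

(** Domination almost everywhere puts a measurable function in [L^2]. *)
Lemma Lfun2_le f g : measurable_fun setT f -> g \in L2 ->
  {ae mu, forall x, `|f x| <= `|g x|} -> f \in L2.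
Proof.
move=> mf gL fg; apply: Lfun2P => //.
have /integrableP[_] := Lfun2_integrable_sqr gL.
apply: le_lt_trans; apply: ae_ge0_le_integral => //.
- by move=> x _; rewrite lee_fin sqr_ge0.
- by apply/measurable_EFinP; exact: measurable_funX.
- apply: measurableT_comp => //; apply/measurable_EFinP; apply: measurable_funX.
  exact: Lfun2_measurable.
- apply: filterS fg => x fgx _ /=.
  rewrite lee_fin -[X in X <= _]ger0_norm ?sqr_ge0// !normrX.
  by rewrite lerXn2r// nnegrE.
Qed.

Lemma Lfun2_bounded f (K : R) : measurable_fun setT f ->
  {ae mu, forall x, `|f x| <= K} -> f \in L2.
Proof.
move=> mf fK; apply: (Lfun2_le mf (Lfun2_cst K)).
by apply: filterS fK => x; move/le_trans; apply; exact: ler_norm.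
Qed.

Lemma Lfun2_pos f : f \in L2 -> (fun x => Num.max (f x) 0) \in L2.
Proof.
move=> fL; apply: Lfun2_le (fL) _.
  by apply: measurable_maxr => //; exact: Lfun2_measurable.
apply: nearW => x; rewrite maxEle; case: ifP => // _; by rewrite normr0.
Qed.

Lemma L2normE f : f \in L2 ->
  L2norm mu f = (Num.sqrt (\int[mu]_x (f x * f x)))%:E.
Proof.
move=> fL; have fi := Lfun2_mul_integrable fL fL.
have n0 : (0 <= L2norm mu f)%E by exact: Lnorm_ge0.
rewrite -[LHS](gee0_abs n0) -sqrte_sqr L2norm_sqr.
by under eq_integral do rewrite expr2; rewrite -EFin_Rintegral.
Qed.

Lemma cauchy_schwarz f g : f \in L2 -> g \in L2 ->
  `|\int[mu]_x (f x * g x)| <=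
  Num.sqrt (\int[mu]_x (f x * f x)) * Num.sqrt (\int[mu]_x (g x * g x)).
Proof.
move=> fL gL; have fgi := Lfun2_mul_integrable fL gL.
rewrite -lee_fin EFinM -!L2normE//.
have := @hoelder _ _ _ mu f g 2 2 (Lfun2_measurable fL) (Lfun2_measurable gL).
have h : 2^-1 + 2^-1 = 1 :> R by rewrite [RHS]splitr !div1r.
move=> /(_ (ltr0n _ 2) (ltr0n _ 2) h).
apply: le_trans; rewrite Lnorm1.
rewrite (EFin_normr_Rintegral measurableT fgi).
by apply: le_abse_integral => //; exact: measurable_int fgi.
Qed.

Lemma Rintegral_cstT (k : R) :
  \int[mu]_x k = k.
Proof.
by rewrite Rintegral_cst// [X in fine X](@probability_setT _ _ _ mu) mulr1.
Qed.

Lemma integral_cstT (k : \bar R) :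
  (\int[mu]_x k = k)%E.
Proof.
by rewrite integral_cst// [X in (_ * X)%E](@probability_setT _ _ _ mu) mule1.
Qed.

Lemma Lfun2_indic (A : set T) :
  measurable A -> (\1_A : T -> R) \in Lfun mu 2%:E.
Proof.
move=> mA; apply: (@Lfun2_bounded _ 1); first exact: measurable_indic.
by apply: nearW => x; rewrite indicE; case: (_ \in _); rewrite ?normr1 ?normr0.
Qed.

Lemma Rintegral_indic (A : set T) :
  measurable A -> (\int[mu]_x \1_A x)%:E = mu A.
Proof.
move=> mA; rewrite EFin_Rintegral; last exact/Lfun2_integrable/Lfun2_indic.
by rewrite integral_indic// setIT.
Qed.

(** Jensen's inequality for the square. When the right-hand side is infinite it
    holds trivially, whatever the value of the Bochner integral. *)
Lemma sqr_Rintegral_le f :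
  measurable_fun setT f ->
  (((\int[mu]_x f x)%R ^+ 2)%:E <= \int[mu]_x (f x ^+ 2)%:E)%E.
Proof.
move=> mf; have [foo|] := ltP (\int[mu]_x (f x ^+ 2)%:E)%E +oo%E; last first.
  by apply: le_trans; rewrite leey.
have fL := Lfun2P mf foo.
have := cauchy_schwarz fL (Lfun2_cst 1).
under eq_Rintegral do rewrite mulr1.
under [X in _ * Num.sqrt X]eq_Rintegral do rewrite mulr1.
rewrite Rintegral_cstT sqrtr1 mulr1 => h.
have : (`|\int[mu]_x f x| ^+ 2 <= \int[mu]_x (f x * f x)).
  rewrite -[leRHS]sqr_sqrtr; last by apply: Rintegral_ge0 => x _; rewrite -expr2 sqr_ge0.
  by rewrite lerXn2r// nnegrE.
rewrite -normrX ger0_norm ?sqr_ge0// -lee_fin => /le_trans; apply.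
rewrite EFin_Rintegral; last exact: Lfun2_mul_integrable.
by under eq_integral do rewrite -expr2.
Qed.

End square_integrable.

(** * Partial integration on a product of probability spaces *)

Section product_space.
Context {R : realType} {d1 d2} {X : measurableType d1} {Y : measurableType d2}.
Variables (P : probability X R) (Q : probability Y R).
Local Notation PQ := ((P \x Q)%E : probability (X * Y)%type R).
Implicit Types (h : X * Y -> R) (u : X -> R) (v : Y -> R).

Lemma Rintegral_prod1 h : PQ.-integrable setT (EFin \o h) ->
  [/\ measurable_fun setT (fun x => \int[Q]_y h (x, y)),
      {ae P, forall x, Q.-integrable setT (EFin \o (fun y => h (x, y)))} &
      \int[PQ]_z h z = \int[P]_x \int[Q]_y h (x, y)].
Proof.
move=> hi; have mF := measurable_fubini_F hi.
have iF := integrable_fubini_F hi.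
have mfF : measurable_fun setT (fun x => \int[Q]_y h (x, y)).
  exact: (measurableT_comp (fine_measurable measurableT) mF).
split => //; first exact: (ae_integrable1 hi).
rewrite {1 2}/Rintegral -(integral12_prod_meas1 hi); congr fine.
apply: ae_eq_integral => //; first exact/measurable_EFinP.
by apply: filterS (integrable_ae measurableT iF) => x /(_ I) /fineK/esym ? _.
Qed.

Lemma Rintegral_prod2 h : PQ.-integrable setT (EFin \o h) ->
  [/\ measurable_fun setT (fun y => \int[P]_x h (x, y)),
      {ae Q, forall y, P.-integrable setT (EFin \o (fun x => h (x, y)))} &
      \int[PQ]_z h z = \int[Q]_y \int[P]_x h (x, y)].
Proof.
move=> hi; have mG := measurable_fubini_G hi.
have iG : Q.-integrable setT (fubini_G P (EFin \o h)).
  apply/integrableP; split => //.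
  have mh := measurable_int _ hi.
  have := (integrable21ltyP P Q mh).1 hi; apply: le_lt_trans.
  apply: ge0_le_integral => //; first exact: measurableT_comp.
    apply: (measurable_fun_fubini_tonelli_G (abse \o (EFin \o h))) => //=.
    exact: measurableT_comp.
  by move=> y _; apply: le_abse_integral => //; exact: measurableT_comp.
have mfG : measurable_fun setT (fun y => \int[P]_x h (x, y)).
  exact: (measurableT_comp (fine_measurable measurableT) mG).
split => //; first exact: (ae_integrable2 hi).
rewrite {1 2}/Rintegral -(integral21_prod_meas1 hi); congr fine.
apply: ae_eq_integral => //; first exact/measurable_EFinP.
by apply: filterS (integrable_ae measurableT iG) => x /(_ I) /fineK/esym ? _.
Qed.

Lemma Lfun2_fst u : u \in Lfun P 2%:E -> (fun z : X * Y => u z.1) \in Lfun PQ 2%:E.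
Proof.
move=> uL; have mu1 : measurable_fun setT (fun z : X * Y => u z.1).
  exact: measurableT_comp (Lfun2_measurable uL) measurable_fst.
apply: Lfun2P => //.
rewrite (fubini_tonelli1 (fun z => (u z.1 ^+ 2)%:E)); last 2 first.
- by apply/measurable_EFinP; exact: measurable_funX.
- by move=> z; rewrite lee_fin sqr_ge0.
rewrite /fubini_F/=; under eq_integral do rewrite integral_cstT.
have /integrableP[_] := Lfun2_integrable_sqr uL.
by under eq_integral do rewrite /= ger0_norm ?sqr_ge0//.
Qed.

Lemma Lfun2_snd v : v \in Lfun Q 2%:E -> (fun z : X * Y => v z.2) \in Lfun PQ 2%:E.
Proof.
move=> vL; have mv : measurable_fun setT (fun z : X * Y => v z.2).
  exact: measurableT_comp (Lfun2_measurable vL) measurable_snd.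
apply: Lfun2P => //.
rewrite (fubini_tonelli2 (fun z => (v z.2 ^+ 2)%:E)); last 2 first.
- by apply/measurable_EFinP; exact: measurable_funX.
- by move=> z; rewrite lee_fin sqr_ge0.
rewrite /fubini_G/=; under eq_integral do rewrite integral_cstT.
have /integrableP[_] := Lfun2_integrable_sqr vL.
by under eq_integral do rewrite /= ger0_norm ?sqr_ge0//.
Qed.

(** Partial integration maps [L^2(P \x Q)] to [L^2(P)]: Jensen on each section,
    then Tonelli. *)
Lemma Lfun2_marginal1 h : h \in Lfun PQ 2%:E ->
  (fun x => \int[Q]_y h (x, y)) \in Lfun P 2%:E.
Proof.
move=> hL; have mh := Lfun2_measurable hL.
have [mF _ _] := Rintegral_prod1 (Lfun2_integrable hL).
apply: Lfun2P => //.
have /integrableP[_] := Lfun2_integrable_sqr hL.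
under eq_integral do rewrite /= ger0_norm ?sqr_ge0//.
have mh2 : measurable_fun setT (fun z : X * Y => (h z ^+ 2)%:E).
  by apply/measurable_EFinP; exact: measurable_funX.
have h20 z : (0 <= (h z ^+ 2)%:E)%E by rewrite lee_fin sqr_ge0.
rewrite (fubini_tonelli1 (fun z => (h z ^+ 2)%:E))//.
apply: le_lt_trans; apply: ge0_le_integral => //.
- by move=> x _; rewrite lee_fin sqr_ge0.
- by apply/measurable_EFinP; exact: measurable_funX.
- exact: measurable_fun_fubini_tonelli_F.
- move=> x _; apply: sqr_Rintegral_le.
  exact: measurableT_comp mh (pair1_measurable x).
Qed.

Lemma Lfun2_marginal2 h : h \in Lfun PQ 2%:E ->
  (fun y => \int[P]_x h (x, y)) \in Lfun Q 2%:E.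
Proof.
move=> hL; have mh := Lfun2_measurable hL.
have [mF _ _] := Rintegral_prod2 (Lfun2_integrable hL).
apply: Lfun2P => //.
have /integrableP[_] := Lfun2_integrable_sqr hL.
under eq_integral do rewrite /= ger0_norm ?sqr_ge0//.
have mh2 : measurable_fun setT (fun z : X * Y => (h z ^+ 2)%:E).
  by apply/measurable_EFinP; exact: measurable_funX.
have h20 z : (0 <= (h z ^+ 2)%:E)%E by rewrite lee_fin sqr_ge0.
rewrite (fubini_tonelli2 (fun z => (h z ^+ 2)%:E))//.
apply: le_lt_trans; apply: ge0_le_integral => //.
- by move=> x _; rewrite lee_fin sqr_ge0.
- by apply/measurable_EFinP; exact: measurable_funX.
- exact: measurable_fun_fubini_tonelli_G.
- move=> y _; apply: sqr_Rintegral_le.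
  exact: measurableT_comp mh (pair2_measurable y).
Qed.

Lemma Rintegral_mul_fst h u : h \in Lfun PQ 2%:E -> u \in Lfun P 2%:E ->
  \int[PQ]_z (h z * u z.1) = \int[P]_x ((\int[Q]_y h (x, y)) * u x).
Proof.
move=> hL uL.
have [mF _ ->] := Rintegral_prod1 (Lfun2_mul_integrable hL (Lfun2_fst uL)).
have [mh ih _] := Rintegral_prod1 (Lfun2_integrable hL).
apply: ae_eq_Rintegral => //.
  by apply: measurable_funM => //; exact: (Lfun2_measurable uL).
by apply: filterS ih => x ih /=; rewrite RintegralZr.
Qed.

Lemma Rintegral_mul_snd h v : h \in Lfun PQ 2%:E -> v \in Lfun Q 2%:E ->
  \int[PQ]_z (h z * v z.2) = \int[Q]_y ((\int[P]_x h (x, y)) * v y).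
Proof.
move=> hL vL.
have [mF _ ->] := Rintegral_prod2 (Lfun2_mul_integrable hL (Lfun2_snd vL)).
have [mh ih _] := Rintegral_prod2 (Lfun2_integrable hL).
apply: ae_eq_Rintegral => //.
  by apply: measurable_funM => //; exact: (Lfun2_measurable vL).
by apply: filterS ih => x ih /=; rewrite RintegralZr.
Qed.

Lemma Rintegral_fst u : u \in Lfun P 2%:E -> \int[PQ]_z u z.1 = \int[P]_x u x.
Proof.
move=> uL; have := Rintegral_mul_fst (Lfun2_cst PQ 1) uL.
under eq_Rintegral do rewrite mul1r; move=> ->.
by apply: eq_Rintegral => x _; rewrite Rintegral_cstT mul1r.
Qed.

Lemma Rintegral_snd v : v \in Lfun Q 2%:E -> \int[PQ]_z v z.2 = \int[Q]_x v x.
Proof.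
move=> vL; have := Rintegral_mul_snd (Lfun2_cst PQ 1) vL.
under eq_Rintegral do rewrite mul1r; move=> ->.
by apply: eq_Rintegral => x _; rewrite Rintegral_cstT mul1r.
Qed.

Lemma Lfun2_oplus u v : u \in Lfun P 2%:E -> v \in Lfun Q 2%:E ->
  oplus u v \in Lfun PQ 2%:E.
Proof. by move=> uL vL; apply: Lfun2D; [exact: Lfun2_fst|exact: Lfun2_snd]. Qed.

(** The pairing of [h] with [u (+) v] only sees the two marginal integrals
    of [h]. *)
Lemma Rintegral_mul_oplus h u v : h \in Lfun PQ 2%:E -> u \in Lfun P 2%:E ->
  v \in Lfun Q 2%:E -> \int[PQ]_z (h z * oplus u v z) =
  \int[P]_x ((\int[Q]_y h (x, y)) * u x) + \int[Q]_y ((\int[P]_x h (x, y)) * v y).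
Proof.
move=> hL uL vL; rewrite -Rintegral_mul_fst// -Rintegral_mul_snd//.
rewrite -RintegralD//; last 2 first.
  by apply: Lfun2_mul_integrable => //; exact: Lfun2_fst.
  by apply: Lfun2_mul_integrable => //; exact: Lfun2_snd.
by apply: eq_Rintegral => z _; rewrite /oplus mulrDr.
Qed.

End product_space.

(** * The gradient of the dual objective *)

(** [t |-> (t)_+ ^ 2] is convex and differentiable, with 2-Lipschitz derivative
    [2 (t)_+]. *)
Lemma pos_part_taylor {R : realType} (s k : R) :
  0 <= Num.max (s + k) 0 ^+ 2 - Num.max s 0 ^+ 2 - 2 * Num.max s 0 * k <= k ^+ 2.
Proof.
rewrite !maxEle; case: (leP (s + k) 0) => h1; case: (leP s 0) => h2.
- by apply/andP; split; nra.
- by apply/andP; split; nra.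
- by apply/andP; split; nra.
- by apply/andP; split; nra.
Qed.

Section gradient.
Context {R : realType} {d : nat}.
Local Notation Rd := ('rV[R]_d).
Variables (P Q : probability Rd R) (c : Rd * Rd -> R) (eps : R).
Local Notation PQ := ((P \x Q)%E : probability (Rd * Rd)%type R).
Hypothesis eps0 : 0 < eps.
Hypothesis cL : c \in Lfun PQ 2%:E.

(** [(h - c)_+]; at the potentials, [eps] times the density of the optimal plan. *)
Definition slack (h : Rd * Rd -> R) : Rd * Rd -> R :=
  fun z => Num.max (h z - c z) 0.

(** The [L^2(P \x Q)]-gradient at [h] of the integral functional [Phi], before
    projection on the space of the [u (+) v]. *)
Definition score (h : Rd * Rd -> R) : Rd * Rd -> R :=
  fun z => 1 - eps^-1 * slack h z.

Lemma Lfun2_slack h : h \in Lfun PQ 2%:E -> slack h \in Lfun PQ 2%:E.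
Proof. by move=> hL; apply/Lfun2_pos/Lfun2B. Qed.

Lemma Lfun2_score h : h \in Lfun PQ 2%:E -> score h \in Lfun PQ 2%:E.
Proof.
by move=> hL; apply: Lfun2B; [exact: Lfun2_cst|exact/Lfun2Z/Lfun2_slack].
Qed.

Lemma Hspace_Lfun2 h : Hspace P Q h -> h \in Lfun PQ 2%:E.
Proof. by move=> [u [v [uL vL ->]]]; exact: Lfun2_oplus. Qed.

Lemma Phi_integrable h : h \in Lfun PQ 2%:E ->
  PQ.-integrable setT
    (EFin \o (fun z => h z - (2 * eps)^-1 * slack h z ^+ 2)).
Proof.
move=> hL; apply: rintegrableB; first exact: Lfun2_integrable.
apply: rintegrableZ; have sL := Lfun2_slack hL.
by have := Lfun2_mul_integrable sL sL; under eq_fun do rewrite -expr2.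
Qed.

(** Upper bound: concavity of [Phi]. Lower bound: the remainder is quadratic. *)
Lemma Phi_taylor h k : h \in Lfun PQ 2%:E -> k \in Lfun PQ 2%:E ->
  - (2 * eps)^-1 * \int[PQ]_z (k z * k z) <=
  Phi P Q c eps (h \+ k) - Phi P Q c eps h - \int[PQ]_z (score h z * k z) <= 0.
Proof.
move=> hL kL; have hkL := Lfun2D hL kL.
have ih := Phi_integrable hL; have ihk := Phi_integrable hkL.
have isk := Lfun2_mul_integrable (Lfun2_score hL) kL.
have ikk := Lfun2_mul_integrable kL kL.
rewrite /Phi -RintegralB// -RintegralB//; last exact: rintegrableB.
have e2 : 0 < (2 * eps)^-1 by rewrite invr_gt0 mulr_gt0.
have key z : ((h \+ k) z - (2 * eps)^-1 * Num.max ((h \+ k) z - c z) 0 ^+ 2) -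
   (h z - (2 * eps)^-1 * Num.max (h z - c z) 0 ^+ 2) - score h z * k z =
   - (2 * eps)^-1 * (Num.max ((h z - c z) + k z) 0 ^+ 2 -
     Num.max (h z - c z) 0 ^+ 2 - 2 * Num.max (h z - c z) 0 * k z).
  have -> : (h \+ k) z - c z = (h z - c z) + k z by rewrite /= addrAC.
  by rewrite /score /slack /=; field; exact: lt0r_neq0.
apply/andP; split.
- rewrite -RintegralZl//; apply: le_Rintegral => //.
  + exact: rintegrableZ.
  + by apply: rintegrableB => //; exact: rintegrableB.
  + move=> z _; rewrite key.
    apply: ler_wnM2l; first by rewrite oppr_le0 ltW.
    by rewrite -expr2; have /andP[] := pos_part_taylor (h z - c z) (k z).
- rewrite -[leRHS](Rintegral_cstT PQ 0); apply: le_Rintegral => //.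
  + by apply: rintegrableB => //; exact: rintegrableB.
  + by apply: Lfun2_integrable; exact: Lfun2_cst.
  + move=> z _; rewrite key mulNr oppr_le0 mulr_ge0 ?(ltW e2)//.
    by have /andP[] := pos_part_taylor (h z - c z) (k z).
Qed.

Variables f g : Rd -> R.
Hypothesis fL : f \in Lfun P 2%:E.
Hypothesis gL : g \in Lfun Q 2%:E.
Let h := oplus f g.
Let hL : h \in Lfun PQ 2%:E. Proof. exact: Lfun2_oplus. Qed.
Let D1 := D1Gamma Q c eps f g.
Let D2 := D2Gamma P c eps f g.

Lemma Lfun2_D1Gamma : D1 \in Lfun P 2%:E.
Proof.
apply: Lfun2B; first exact: Lfun2_cst.
exact/Lfun2Z/(Lfun2_marginal1 (Lfun2_slack hL)).
Qed.

Lemma Lfun2_D2Gamma : D2 \in Lfun Q 2%:E.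
Proof.
apply: Lfun2B; first exact: Lfun2_cst.
exact/Lfun2Z/(Lfun2_marginal2 (Lfun2_slack hL)).
Qed.

(** [(D1Gamma, D2Gamma)] represents the differential of [Gamma]. *)
Lemma score_oplus u v : u \in Lfun P 2%:E -> v \in Lfun Q 2%:E ->
  \int[PQ]_z (score h z * oplus u v z) =
  \int[P]_x (D1 x * u x) + \int[Q]_y (D2 y * v y).
Proof.
move=> uL vL; have uvL := Lfun2_oplus uL vL; have sL := Lfun2_slack hL.
have m1L := Lfun2_marginal1 sL; have m2L := Lfun2_marginal2 sL.
rewrite (@eq_Rintegral _ _ _ _ _ (fun z => oplus u v z - eps^-1 * (slack h z * oplus u v z))); last first.
  by move=> z _; rewrite /score mulrBl mul1r mulrA.
rewrite RintegralB//; last 2 first.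
- exact: Lfun2_integrable.
- exact/rintegrableZ/Lfun2_mul_integrable.
rewrite RintegralZl//; last exact: Lfun2_mul_integrable.
rewrite Rintegral_mul_oplus//.
rewrite /oplus RintegralD//; last 2 first.
- exact/Lfun2_integrable/Lfun2_fst.
- exact/Lfun2_integrable/Lfun2_snd.
rewrite Rintegral_fst// Rintegral_snd//.
rewrite [in RHS](@eq_Rintegral _ _ _ _ _ (fun x => u x - eps^-1 * ((\int[Q]_y slack h (x, y)) * u x))); last first.
  by move=> x _; rewrite /D1 /D1Gamma mulrBl mul1r mulrA.
rewrite [X in _ = _ + X](@eq_Rintegral _ _ _ _ _ (fun y => v y - eps^-1 * ((\int[P]_x slack h (x, y)) * v y))); last first.
  by move=> x _; rewrite /D2 /D2Gamma mulrBl mul1r mulrA.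
rewrite RintegralB//; last 2 first.
- exact: Lfun2_integrable.
- exact/rintegrableZ/Lfun2_mul_integrable.
rewrite RintegralB//; last 2 first.
- exact: Lfun2_integrable.
- exact/rintegrableZ/Lfun2_mul_integrable.
rewrite !RintegralZl//; try exact: Lfun2_mul_integrable.
by rewrite mulrDr; ring.
Qed.

(** The common mean of [D1Gamma] and [D2Gamma]. *)
Definition mean_score : R := \int[PQ]_z score h z.

Lemma mean_D1Gamma : \int[P]_x D1 x = mean_score.
Proof.
rewrite /mean_score [RHS](@eq_Rintegral _ _ _ _ _ (fun z => score h z * oplus (fun=> 1) (fun=> 0) z)); last first.
  by move=> z _; rewrite /oplus addr0 mulr1.
rewrite score_oplus//; try exact: Lfun2_cst.
rewrite [X in _ = _ + X](@eq_Rintegral _ _ _ _ _ (fun=> 0)); last first.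
  by move=> y _; rewrite mulr0.
by rewrite Rintegral_cstT addr0; apply: eq_Rintegral => x _; rewrite mulr1.
Qed.

Lemma mean_D2Gamma : \int[Q]_y D2 y = mean_score.
Proof.
rewrite /mean_score [RHS](@eq_Rintegral _ _ _ _ _ (fun z => score h z * oplus (fun=> 0) (fun=> 1) z)); last first.
  by move=> z _; rewrite /oplus add0r mulr1.
rewrite score_oplus//; try exact: Lfun2_cst.
rewrite [X in _ = X + _](@eq_Rintegral _ _ _ _ _ (fun=> 0)); last first.
  by move=> y _; rewrite mulr0.
by rewrite Rintegral_cstT add0r; apply: eq_Rintegral => x _; rewrite mulr1.
Qed.

(** The orthogonal projection of the score on the space of the [u (+) v]; the
    mean is subtracted because it is contained in both partial gradients. *)
Definition Hgrad : Rd * Rd -> R := oplus D1 (fun y => D2 y - mean_score).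

Let D2mL : (fun y => D2 y - mean_score) \in Lfun Q 2%:E.
Proof. by apply: Lfun2B; [exact: Lfun2_D2Gamma|exact: Lfun2_cst]. Qed.

Lemma Lfun2_Hgrad : Hgrad \in Lfun PQ 2%:E.
Proof. by apply: Lfun2_oplus; [exact: Lfun2_D1Gamma|]. Qed.

Lemma Hgrad_oplus u v : u \in Lfun P 2%:E -> v \in Lfun Q 2%:E ->
  \int[PQ]_z (Hgrad z * oplus u v z) =
  \int[P]_x (D1 x * u x) + \int[Q]_y (D2 y * v y).
Proof.
move=> uL vL; rewrite (Rintegral_mul_oplus Lfun2_Hgrad)//; congr (_ + _).
- apply: eq_Rintegral => x _; congr (_ * _); rewrite /Hgrad /oplus/=.
  rewrite RintegralD//; last 2 first.
  + exact/Lfun2_integrable/Lfun2_cst.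
  + exact: Lfun2_integrable.
  rewrite RintegralB//; last 2 first.
  + exact/Lfun2_integrable/Lfun2_D2Gamma.
  + exact/Lfun2_integrable/Lfun2_cst.
  by rewrite !Rintegral_cstT mean_D2Gamma subrr addr0.
- apply: eq_Rintegral => y _; congr (_ * _); rewrite /Hgrad /oplus/=.
  rewrite RintegralD//; last 2 first.
  + exact/Lfun2_integrable/Lfun2_D1Gamma.
  + exact/Lfun2_integrable/Lfun2_cst.
  by rewrite Rintegral_cstT mean_D1Gamma addrC subrK.
Qed.

Lemma Hgrad_score k : Hspace P Q k ->
  \int[PQ]_z (Hgrad z * k z) = \int[PQ]_z (score h z * k z).
Proof.
by move=> [u [v [uL vL ->]]]; rewrite Hgrad_oplus// score_oplus.
Qed.

Lemma Hgrad_sqnorm : \int[PQ]_z (Hgrad z * Hgrad z) =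
  \int[P]_x (D1 x * D1 x) + \int[Q]_y (D2 y * D2 y) - mean_score ^+ 2.
Proof.
have D2L := Lfun2_D2Gamma.
rewrite {2}/Hgrad Hgrad_oplus//; last exact: Lfun2_D1Gamma.
rewrite -addrA; congr (_ + _).
under eq_Rintegral do rewrite mulrBr.
rewrite RintegralB//; last 2 first.
- exact: Lfun2_mul_integrable.
- by apply: Lfun2_mul_integrable => //; exact: Lfun2_cst.
by rewrite RintegralZr ?mean_D2Gamma ?expr2//; exact: Lfun2_integrable.
Qed.

Lemma HspaceD k l : Hspace P Q k -> Hspace P Q l -> Hspace P Q (k \+ l).
Proof.
move=> [u [v [uL vL ->]]] [u' [v' [u'L v'L ->]]].
exists (fun x => u x + u' x), (fun y => v y + v' y).
split; [exact: Lfun2D|exact: Lfun2D|].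
by apply/funext => z; rewrite /oplus/=; ring.
Qed.

Lemma HspaceZ (a : R) k : Hspace P Q k -> Hspace P Q (fun z => a * k z).
Proof.
move=> [u [v [uL vL ->]]]; exists (fun x => a * u x), (fun y => a * v y).
split; [exact: Lfun2Z|exact: Lfun2Z|].
by apply/funext => z; rewrite /oplus/=; ring.
Qed.

(** [Phi] is differentiable, so that the default value in the definition of
    [DPhi] is not taken. *)
Lemma is_Hgradient_Hgrad : is_Hgradient P Q c eps h Hgrad.
Proof.
split.
  exists D1, (fun y => D2 y - mean_score); split => //; exact: Lfun2_D1Gamma.
move=> eta eta0; exists (2 * eps * eta); first by rewrite !mulr_gt0.
move=> k kH; have kL := Hspace_Lfun2 kH; rewrite Hgrad_score//.
rewrite (@L2normE _ _ _ PQ)// lee_fin => kr.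
rewrite -EFinM lee_fin.
set n := Num.sqrt _ in kr *; have n0 : 0 <= n by exact: sqrtr_ge0.
have nn : \int[PQ]_z (k z * k z) = n * n.
  rewrite -expr2 sqr_sqrtr//; apply: Rintegral_ge0 => z _.
  by rewrite -expr2 sqr_ge0.
have /andP[h1 h2] := Phi_taylor hL kL.
rewrite ler0_norm// lerNl; apply: le_trans h1.
rewrite nn mulNr lerN2 mulrA ler_wpM2r//.
by rewrite mulrC ler_pdivrMr ?mulr_gt0// mulrC.
Qed.

(* Testing two gradients against a small multiple of their difference. *)
Lemma is_Hgradient_unique w w' : is_Hgradient P Q c eps h w ->
  is_Hgradient P Q c eps h w' ->
  \int[PQ]_z ((w z - w' z) * (w z - w' z)) = 0.
Proof.
move=> [wH wg] [w'H w'g]; have wL := Hspace_Lfun2 wH; have w'L := Hspace_Lfun2 w'H.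
pose e z := w z - w' z.
have eH : Hspace P Q e.
  have := HspaceD wH (HspaceZ (-1) w'H).
  by under [in X in Hspace _ _ X -> _]eq_fun do rewrite /= mulN1r.
have eL := Hspace_Lfun2 eH.
pose n := Num.sqrt (\int[PQ]_z (e z * e z)).
have nn : \int[PQ]_z (e z * e z) = n * n.
  rewrite -expr2 sqr_sqrtr//; apply: Rintegral_ge0 => z _.
  by rewrite -expr2 sqr_ge0.
have [n0|npos] := eqVneq n 0; first by rewrite -/e nn n0 mulr0.
have {}npos : 0 < n by rewrite lt_neqAle eq_sym npos sqrtr_ge0.
have eta0 : 0 < n / 4 by rewrite divr_gt0.
have [r r0 hr] := wg _ eta0; have [r' r'0 hr'] := w'g _ eta0.
pose t := Num.min r r' / n.
have t0 : 0 < t by rewrite divr_gt0// lt_min r0 r'0.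
pose k z := t * e z.
have kH : Hspace P Q k by exact: HspaceZ.
have kL := Hspace_Lfun2 kH.
have kn : L2norm PQ k = (t * n)%:E.
  rewrite L2normE//; congr EFin.
  rewrite (@eq_Rintegral _ _ _ _ _ (fun z => t * t * (e z * e z))); last first.
    by move=> z _; rewrite /k; ring.
  rewrite RintegralZl//; last exact: Lfun2_mul_integrable.
  have t20 : 0 <= t * t by rewrite -expr2 sqr_ge0.
  by rewrite (sqrtrM _ t20) -(expr2 t) sqrtr_sqr gtr0_norm.
have tn : t * n = Num.min r r' by rewrite /t divfK// gt_eqF.
have m1 : Num.min r r' <= r by rewrite ge_min lexx.
have m2 : Num.min r r' <= r' by rewrite ge_min lexx orbT.
have := hr k kH; have := hr' k kH; rewrite kn -!EFinM !lee_fin tn.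
move=> /(_ m2) h1 /(_ m1) h2.
have := lerD h2 h1; rewrite -tn => h3.
have : t * (n * n) <= n / 4 * (t * n) + n / 4 * (t * n).
  apply: le_trans h3.
  have -> : t * (n * n) = \int[PQ]_z (w z * k z) - \int[PQ]_z (w' z * k z).
    rewrite -nn -RintegralZl//; last exact: Lfun2_mul_integrable.
    rewrite -RintegralB//; try exact: Lfun2_mul_integrable.
    by apply: eq_Rintegral => z _; rewrite /k /e; ring.
  set A := Phi _ _ _ _ _ - _; set I1 := Rintegral _ _ _; set I2 := Rintegral _ _ _.
  by rewrite (le_trans (ler_norm _))// [X in _ <= X + _]distrC ler_distD.
have : 0 < t * (n * n) by apply: mulr_gt0 => //; exact: mulr_gt0.
have -> : n / 4 * (t * n) + n / 4 * (t * n) = t * (n * n) / 2 by field.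
by move=> a0; rewrite ler_pdivlMr// ger_pMr// leNgt ltr1n.
Qed.

Lemma L2norm_DPhi :
  L2norm PQ (DPhi P Q c eps h) = L2norm PQ Hgrad.
Proof.
have wg : is_Hgradient P Q c eps h (DPhi P Q c eps h).
  exact: (xgetPex (cst 0) (ex_intro _ _ is_Hgradient_Hgrad)).
have wL := Hspace_Lfun2 wg.1.
have := is_Hgradient_unique wg is_Hgradient_Hgrad.
set w := DPhi _ _ _ _ _ in wg wL * => e0.
have eL := Lfun2B wL Lfun2_Hgrad.
have L0 : Num.sqrt (\int[PQ]_z ((w z - Hgrad z) * (w z - Hgrad z))) = 0.
  by rewrite e0 sqrtr0.
rewrite !(@L2normE _ _ _ PQ)//; last exact: Lfun2_Hgrad.
have GL := Lfun2_Hgrad.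
(* a null difference does not change the norm, by Cauchy-Schwarz *)
have h1 := cauchy_schwarz eL wL; have h2 := cauchy_schwarz eL GL.
rewrite L0 mul0r normr_le0 in h1; rewrite L0 mul0r normr_le0 in h2.
congr (EFin (Num.sqrt _)).
rewrite -[RHS]addr0 -[X in _ = _ + X](addr0 0) -{1}(eqP h1) -(eqP h2).
rewrite -!RintegralD//; try exact: Lfun2_mul_integrable.
  by apply: eq_Rintegral => z _; ring.
by apply: rintegrableD; exact: Lfun2_mul_integrable.
Qed.

(** The gradient of [Phi] is the shorter one: by [Hgrad_sqnorm] the squared norms
    differ by [mean_score ^+ 2]. *)
Lemma L2norm_Hgrad_le : (L2norm PQ Hgrad <= DGamma_norm P Q c eps f g)%E.
Proof.
rewrite (@L2normE _ _ _ PQ); last exact: Lfun2_Hgrad.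
rewrite /DGamma_norm -/D1 -/D2.
rewrite (L2normE Lfun2_D1Gamma) (L2normE Lfun2_D2Gamma).
rewrite -!EFin_expe -EFinD/= lee_fin ler_wsqrtr// Hgrad_sqnorm.
rewrite !sqr_sqrtr; last 2 first.
- by apply: Rintegral_ge0 => z _; rewrite -expr2 sqr_ge0.
- by apply: Rintegral_ge0 => z _; rewrite -expr2 sqr_ge0.
by rewrite gerBl sqr_ge0.
Qed.

End gradient.

(** * Probability measures with a square-integrable density *)

Section density_probability.
Local Open Scope charge_scope.
Context {R : realType} {disp} {T : measurableType disp}.
Variables (mu : probability T R) (p : T -> R).
Hypothesis p0 : forall x, 0 <= p x.
Hypothesis pL : p \in Lfun mu 2%:E.
Hypothesis p1 : \int[mu]_x p x = 1.

(** The probability measure with density [p] with respect to [mu]. *)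
Definition density_prob (A : set T) : \bar R := (\int[mu]_(x in A) (p x)%:E)%E.

Let mp : measurable_fun setT (EFin \o p).
Proof. by apply/measurable_EFinP; exact: Lfun2_measurable pL. Qed.

Let density0 : density_prob set0 = 0%E.
Proof. by rewrite /density_prob integral_set0. Qed.

Let density_ge0 A : (0 <= density_prob A)%E.
Proof. by apply: integral_ge0 => x _; rewrite lee_fin. Qed.

Let density_sigma_additive : semi_sigma_additive density_prob.
Proof.
move=> /= A mA tA mUA; rewrite /density_prob/= ge0_integral_bigcup//=.
- apply: is_cvg_ereal_nneg_natsum_cond => n _ _.
  by apply: integral_ge0 => /= x ?; rewrite lee_fin.
- exact: measurable_funTS.
- by move=> x _; rewrite lee_fin.
Qed.

HB.instance Definition _ := isMeasure.Build _ _ _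
  density_prob density0 density_ge0 density_sigma_additive.

Let density_setT : density_prob setT = 1%E.
Proof.
by rewrite /density_prob -(EFin_Rintegral (Lfun2_integrable pL)) p1.
Qed.

HB.instance Definition _ :=
  @Measure_isProbability.Build _ _ R density_prob density_setT.

Let pi : probability T R := density_prob.

Let pi_dom : pi `<< mu.
Proof.
apply/null_content_dominatesP => A mA muA0.
by apply: null_set_integral => //; exact: measurable_funTS.
Qed.

(** The density measure is packaged with what the transport cost needs: the
    squared norm of its density and the expectations of [L^2(mu)] functions. *)
Lemma density_prob_exists : exists nu : probability T R,
  [/\ forall A, measurable A -> nu A = (\int[mu]_(x in A) (p x)%:E)%E,
      nu `<< mu,
      ('N[mu]_2%:E ['d (charge_of_finite_measure nu) '/d mu] ^+ 2 =
        (\int[mu]_x (p x * p x))%:E)%E &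
      forall phi : T -> R, phi \in Lfun mu 2%:E ->
        (\int[nu]_z (phi z)%:E = (\int[mu]_x (phi x * p x))%:E)%E].
Proof.
have pp := Lfun2_mul_integrable pL pL.
have ae1 : ae_eq mu setT (Radon_Nikodym_SigmaFinite.f pi mu) (EFin \o p).
  apply: integral_ae_eq => //; first exact: Radon_Nikodym_SigmaFinite.f_integrable.
  by move=> A _ mA; rewrite -Radon_Nikodym_SigmaFinite.f_integral.
have ae2 : ae_eq mu setT ('d (charge_of_finite_measure pi) '/d mu) (EFin \o p).
  apply: ae_eq_trans ae1; apply: ae_eq_sym.
  exact: ae_eq_Radon_Nikodym_SigmaFinite.
exists pi; split => //.
- have -> : 'N[mu]_2%:E ['d (charge_of_finite_measure pi) '/d mu]%E = L2norm mu p.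
    rewrite /L2norm unlock; congr (_ `^ _)%E; apply: ae_eq_integral => //.
    + apply: (measurableT_comp (measurable_poweR 2)).
      apply: measurableT_comp => //; exact: measurable_int (Radon_Nikodym_integrable pi_dom).
    + apply: (measurableT_comp (measurable_poweR 2)).
      exact: measurableT_comp.
    + by apply: filterS ae2 => x /(_ I) -> .
  by rewrite L2norm_sqr; under eq_integral do rewrite expr2; rewrite -EFin_Rintegral.
- move=> phi phiL; have mphi := Lfun2_measurable phiL.
  have phip := Lfun2_mul_integrable phiL pL.
  have mephi : measurable_fun setT (EFin \o phi) by exact/measurable_EFinP.
  have iphi : pi.-integrable setT (EFin \o phi).
    apply/integrableP; split => //.
    rewrite -(Radon_Nikodym_SigmaFinite.change_of_variables pi_dom)//; last exact: measurableT_comp.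
    have /integrableP[_] := phip; apply: le_lt_trans.
    apply: ae_ge0_le_integral => //.
    + move=> x _; apply: mule_ge0 => //.
      exact: Radon_Nikodym_SigmaFinite.f_ge0.
    + apply: emeasurable_funM; first exact: measurableT_comp.
      exact: measurable_int (Radon_Nikodym_SigmaFinite.f_integrable pi_dom).
    + apply: measurableT_comp => //; exact: measurable_int phip.
    + apply: filterS ae1 => x /(_ I) -> _ /=.
      by rewrite -EFinM lee_fin normrM (ger0_norm (p0 x)).
  rewrite -(Radon_Nikodym_change_of_variables pi_dom)// EFin_Rintegral//.
  apply: ae_eq_integral => //.
  + by apply: emeasurable_funM; first exact: mephi.
  + exact: measurable_int phip.
  + by apply: filterS ae2 => x /(_ I) -> _.
Qed.

End density_probability.

(** * Weak duality and gradient domination *)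

Section duality.
Context {R : realType} {d : nat}.
Local Notation Rd := ('rV[R]_d).
Variables (P Q : probability Rd R) (c : Rd * Rd -> R) (eps : R).
Local Notation PQ := ((P \x Q)%E : probability (Rd * Rd)%type R).
Hypothesis eps0 : 0 < eps.
Hypothesis cL : c \in Lfun PQ 2%:E.
Variables fs gs : Rd -> R.
Hypothesis fsL : fs \in Lfun P 2%:E.
Hypothesis gsL : gs \in Lfun Q 2%:E.
Let hs := oplus fs gs.
Hypothesis marg1 : {ae P, forall x, \int[Q]_y slack c hs (x, y) = eps}.
Hypothesis marg2 : {ae Q, forall y, \int[P]_x slack c hs (x, y) = eps}.
Let hsL : hs \in Lfun PQ 2%:E. Proof. exact: Lfun2_oplus. Qed.
Let s := slack c hs.
Let sL : s \in Lfun PQ 2%:E. Proof. exact: Lfun2_slack. Qed.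

(** The optimality system: both marginals of [slack c hs] are constant. *)
Lemma slack_oplus u v : u \in Lfun P 2%:E -> v \in Lfun Q 2%:E ->
  \int[PQ]_z (s z * oplus u v z) = eps * \int[PQ]_z oplus u v z.
Proof.
move=> uL vL; rewrite Rintegral_mul_oplus//.
have := Lfun2_measurable (Lfun2_marginal1 sL).
have := Lfun2_measurable (Lfun2_marginal2 sL) => m2 m1.
have mu := Lfun2_measurable uL; have mv := Lfun2_measurable vL.
rewrite [X in X + _](@ae_eq_Rintegral _ _ _ _ _ (fun x => eps * u x)); last 3 first.
- exact: measurable_funM.
- exact: measurable_funM.
- by apply: filterS marg1 => x ->.
rewrite [X in _ + X](@ae_eq_Rintegral _ _ _ _ _ (fun x => eps * v x)); last 3 first.
- exact: measurable_funM.
- exact: measurable_funM.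
- by apply: filterS marg2 => x ->.
rewrite !RintegralZl//; try exact: Lfun2_integrable.
rewrite -mulrDr /oplus RintegralD//; last 2 first.
- exact/Lfun2_integrable/Lfun2_fst.
- exact/Lfun2_integrable/Lfun2_snd.
by rewrite Rintegral_fst// Rintegral_snd.
Qed.

Let p z := eps^-1 * s z.
Let pL : p \in Lfun PQ 2%:E. Proof. exact: Lfun2Z. Qed.
Let p0 z : 0 <= p z.
Proof. by rewrite mulr_ge0 ?invr_ge0 ?(ltW eps0)// /s /slack le_max lexx orbT. Qed.

(** [p = slack c hs / eps] has marginals [P] and [Q]. *)
Lemma plan_oplus u v : u \in Lfun P 2%:E -> v \in Lfun Q 2%:E ->
  \int[PQ]_z (oplus u v z * p z) = \int[PQ]_z oplus u v z.
Proof.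
move=> uL vL; have uvL := Lfun2_oplus uL vL.
rewrite (@eq_Rintegral _ _ _ _ _ (fun z => eps^-1 * (s z * oplus u v z))); last first.
  by move=> z _; rewrite /p; ring.
rewrite RintegralZl//; last exact: Lfun2_mul_integrable.
by rewrite slack_oplus// mulKf// gt_eqF.
Qed.

Let p1 : \int[PQ]_z p z = 1.
Proof.
have := plan_oplus (Lfun2_cst P 1) (Lfun2_cst Q 0).
under eq_Rintegral do rewrite /oplus addr0 mul1r.
by move=> ->; under eq_Rintegral do rewrite /oplus addr0; rewrite Rintegral_cstT.
Qed.

(** The plan with density [slack c hs / eps] has cost [Gamma fs gs]: on
    [slack != 0], the cost [c] equals [hs - slack]. *)
Lemma QOT_le_Gamma : (QOT P Q c eps <= (Gamma P Q c eps fs gs)%:E)%E.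
Proof.
have [pi [piE pidom pinorm piint]] := density_prob_exists p0 pL p1.
apply: ge_ereal_inf; exists ((Gamma P Q c eps fs gs)%:E) => //.
exists pi.
  split => A mA.
  - rewrite piE; last by rewrite -[X in measurable X]setTI; exact: measurable_fst.
    have AL := Lfun2_indic P mA; have OL := Lfun2_cst Q 0.
    have AOL := Lfun2_oplus AL OL.
    rewrite integral_mkcond (@eq_integral _ _ _ _ _ (fun z => (oplus \1_A (fun=> 0) z * p z)%:E)); last first.
      move=> z _; rewrite patchE /oplus addr0 indicE.
      have -> : (z \in fst @^-1` A) = (z.1 \in A) by apply/idP/idP; rewrite !inE.
      by case: (z.1 \in A); rewrite ?mul1r ?mul0r.
    rewrite -EFin_Rintegral; last exact: Lfun2_mul_integrable.
    rewrite plan_oplus//; under eq_Rintegral do rewrite /oplus addr0.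
    by rewrite (Rintegral_fst Q AL) Rintegral_indic.
  - rewrite piE; last by rewrite -[X in measurable X]setTI; exact: measurable_snd.
    have AL := Lfun2_indic Q mA; have OL := Lfun2_cst P 0.
    have AOL := Lfun2_oplus OL AL.
    rewrite integral_mkcond (@eq_integral _ _ _ _ _ (fun z => (oplus (fun=> 0) \1_A z * p z)%:E)); last first.
      move=> z _; rewrite patchE /oplus add0r indicE.
      have -> : (z \in snd @^-1` A) = (z.2 \in A) by apply/idP/idP; rewrite !inE.
      by case: (z.2 \in A); rewrite ?mul1r ?mul0r.
    rewrite -EFin_Rintegral; last exact: Lfun2_mul_integrable.
    rewrite plan_oplus//; under eq_Rintegral do rewrite /oplus add0r.
    by rewrite (Rintegral_snd P AL) Rintegral_indic.
rewrite /density_sqnorm; case: asboolP => // _.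
rewrite [X in (_ * X)%E]pinorm piint// -EFinM -EFinD; congr EFin.
have hp := Lfun2_mul_integrable hsL pL; have ss := Lfun2_mul_integrable sL sL.
rewrite -RintegralZl//; last exact: Lfun2_mul_integrable.
rewrite -RintegralD//; last 2 first.
- exact: Lfun2_mul_integrable.
- exact/rintegrableZ/Lfun2_mul_integrable.
rewrite (@eq_Rintegral _ _ _ _ _ (fun z => hs z * p z - (2 * eps)^-1 * (s z * s z))); last first.
  move=> z _; have sq : s z * s z = (hs z - c z) * s z.
    by rewrite /s /slack maxEle; case: ifP; rewrite ?mulr0.
  have -> : c z * p z = hs z * p z - eps^-1 * (s z * s z) by rewrite sq /p; ring.
  by rewrite /p; field; exact: lt0r_neq0.
rewrite RintegralB//; last exact: rintegrableZ.
rewrite plan_oplus// -RintegralB//; last 2 first.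
- exact: Lfun2_integrable.
- exact: rintegrableZ.
Qed.

Variables f g : Rd -> R.
Hypothesis fL : f \in Lfun P 2%:E.
Hypothesis gL : g \in Lfun Q 2%:E.
Let h := oplus f g.
Let hL : h \in Lfun PQ 2%:E. Proof. exact: Lfun2_oplus. Qed.
Let diff := oplus f g \- oplus fs gs.

Let diffE : diff = oplus (fun x => f x - fs x) (fun y => g y - gs y).
Proof. by apply/funext => z; rewrite /diff /oplus/=; ring. Qed.

Let diffH : Hspace P Q diff.
Proof.
by rewrite diffE; exists (fun x => f x - fs x), (fun y => g y - gs y);
  split => //; exact: Lfun2B.
Qed.

Let diffL : diff \in Lfun PQ 2%:E. Proof. exact: Hspace_Lfun2. Qed.

(** The score at [hs] is orthogonal to every [u (+) v], so the score at [h] can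
    be replaced by a difference of slacks. *)
Lemma score_diff : - (\int[PQ]_z (score c eps h z * diff z)) =
  eps^-1 * \int[PQ]_z ((slack c h z - slack c hs z) * diff z).
Proof.
have ssL := Lfun2B (Lfun2_slack cL hL) sL.
have : \int[PQ]_z (score c eps hs z * diff z) = 0.
  rewrite (@eq_Rintegral _ _ _ _ _ (fun z => diff z - eps^-1 * (s z * diff z))); last first.
    by move=> z _; rewrite /score mulrBl mul1r mulrA.
  have sdi := Lfun2_mul_integrable sL diffL.
  rewrite RintegralB//; last 2 first.
  - exact: Lfun2_integrable.
  - exact: rintegrableZ.
  rewrite RintegralZl// diffE slack_oplus; try exact: Lfun2B.
  by rewrite mulKf ?subrr// gt_eqF.
move=> h0; rewrite -[LHS]add0r -h0 -RintegralB//; last 2 first.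
- by apply: Lfun2_mul_integrable => //; exact: Lfun2_score.
- by apply: Lfun2_mul_integrable => //; exact: Lfun2_score.
rewrite -RintegralZl//; last exact: Lfun2_mul_integrable.
by apply: eq_Rintegral => z _; rewrite /score; ring.
Qed.

(** A lower bound on [- <D Phi(h), h - hs>] by the squared distance yields both
    the error bound and the gradient domination inequality, for [Phi] and for
    [Gamma]. *)
Lemma gradient_dominance (G : R) : 0 < G ->
  \int[PQ]_z (diff z * diff z) <= G * - (\int[PQ]_z (score c eps h z * diff z)) ->
  let DPhi_norm := L2norm (P \x Q)%E (DPhi P Q c eps (oplus f g)) in
  let DGam_norm := DGamma_norm P Q c eps f g in
  ((L2norm (P \x Q) diff <= G%:E * DPhi_norm)%E /\
   ((G^-1)%:E * (QOT P Q c eps - (Phi P Q c eps (oplus f g))%:E)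
      <= DPhi_norm ^+ 2)%E) /\
  ((L2norm (P \x Q) diff <= G%:E * DGam_norm)%E /\
   ((G^-1)%:E * (QOT P Q c eps - (Gamma P Q c eps f g)%:E)
      <= DGam_norm ^+ 2)%E).
Proof.
move=> G0 coer.
have wL := Lfun2_Hgrad eps cL fL gL; set w := Hgrad P Q c eps f g in wL.
have DPhiE : L2norm (P \x Q)%E (DPhi P Q c eps (oplus f g)) =
    (Num.sqrt (\int[PQ]_z (w z * w z)))%:E.
  by rewrite (L2norm_DPhi eps0 cL fL gL) (L2normE wL).
have diffN : L2norm (P \x Q)%E diff = (Num.sqrt (\int[PQ]_z (diff z * diff z)))%:E.
  exact: (L2normE diffL).
have wle : ((Num.sqrt (\int[PQ]_z (w z * w z)))%:E <= DGamma_norm P Q c eps f g)%E.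
  by rewrite -(L2normE wL); exact: L2norm_Hgrad_le.
set n := Num.sqrt (\int[PQ]_z (w z * w z)) in DPhiE wle.
set N := Num.sqrt _ in diffN.
have n0 : 0 <= n by exact: sqrtr_ge0.
have N0 : 0 <= N by exact: sqrtr_ge0.
have NN : \int[PQ]_z (diff z * diff z) = N * N.
  rewrite -expr2 sqr_sqrtr//; apply: Rintegral_ge0 => z _.
  by rewrite -expr2 sqr_ge0.
(* the projected score pairs with [diff] as the score does *)
have scw : - (\int[PQ]_z (score c eps h z * diff z)) <= n * N.
  rewrite -(Hgrad_score eps cL fL gL diffH).
  apply: le_trans (cauchy_schwarz wL diffL); rewrite -normrN; exact: ler_norm.
have NG : N <= G * n.
  have [->|N1] := eqVneq N 0; first by rewrite mulr_ge0// ltW.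
  have Npos : 0 < N by rewrite lt_neqAle eq_sym N1.
  rewrite -(ler_pM2r Npos) -NN; apply: le_trans coer _.
  by rewrite -mulrA ler_pM2l.
have gap : (QOT P Q c eps - (Gamma P Q c eps f g)%:E <= (G * (n * n))%:E)%E.
  apply: le_trans (leeB QOT_le_Gamma (lexx _)) _.
  rewrite -EFinB lee_fin.
  have kL : (fun z => - diff z) \in Lfun PQ 2%:E by exact: Lfun2N.
  have /andP[_] := Phi_taylor eps0 cL hL kL.
  have -> : h \+ (fun z => - diff z) = hs.
    by apply/funext => z; rewrite /h /hs /diff/=; ring.
  rewrite subr_le0 => /le_trans; apply.
  under eq_Rintegral do rewrite mulrN.
  rewrite (_ : Rintegral _ _ _ = - (\int[PQ]_z (score c eps h z * diff z))); last first.
    rewrite -[RHS]mulN1r -RintegralZl//; first by apply: eq_Rintegral => z _; rewrite mulN1r.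
    by apply: Lfun2_mul_integrable => //; exact: Lfun2_score.
  apply: le_trans scw _; rewrite mulrCA; exact: ler_wpM2l.
have gap' : ((G^-1)%:E * (QOT P Q c eps - (Gamma P Q c eps f g)%:E) <= n%:E ^+ 2)%E.
  apply: (@le_trans _ _ ((G^-1)%:E * (G * (n * n))%:E)%E).
    by apply: lee_wpmul2l => //; rewrite lee_fin invr_ge0 ltW.
  by rewrite -EFinM -EFin_expe lee_fin mulKf ?expr2// gt_eqF.
cbv zeta; rewrite DPhiE diffN; split; split.
- by rewrite -EFinM lee_fin.
- exact: gap'.
- apply: le_trans (_ : ((G * n)%:E <= _)%E); first by rewrite lee_fin.
  by rewrite EFinM; apply: lee_wpmul2l => //; rewrite lee_fin ltW.
- apply: le_trans gap' _; rewrite !expe2.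
  by apply: lee_pmul; rewrite ?lee_fin.
Qed.

End duality.

(** * Coercivity on a subset of the product *)

Section coercivity.
Context {R : realType} {d1 d2} {X : measurableType d1} {Y : measurableType d2}.
Variables (P : probability X R) (Q : probability Y R).
Local Notation PQ := ((P \x Q)%E : probability (X * Y)%type R).
Variables (O1 : set X) (O2 : set Y).
Hypothesis mO1 : measurable O1.
Hypothesis mO2 : measurable O2.
Hypothesis PO1 : P (~` O1) = 0%E.
Hypothesis QO2 : Q (~` O2) = 0%E.
Variables (S : set (X * Y)) (N : set (X * X)).
Hypothesis mS : measurable S.
Hypothesis mN : measurable N.
Variables p0 q0 B : R.
Hypothesis p00 : 0 < p0.
Hypothesis p01 : p0 <= 1.
Hypothesis q00 : 0 < q0.
Hypothesis Bq : q0 <= B.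
Hypothesis overlap : forall x z, O1 x -> O1 z -> N (x, z) ->
  (q0%:E <= Q [set y | S (x, y) /\ S (z, y)])%E.
Hypothesis thick : forall y, O2 y -> (p0%:E <= P [set x | S (x, y)])%E.
Variables (u : X -> R) (v : Y -> R).
Hypothesis uL : u \in Lfun P 2%:E.
Hypothesis vL : v \in Lfun Q 2%:E.
Hypothesis poincare :
  (\int[P]_x \int[P]_z ((u x - u z) ^+ 2)%:E <=
   B%:E * \int[P]_x \int[P]_z ((u x - u z) ^+ 2 * \1_N (x, z))%:E)%E.
Let w := oplus u v.
Let wL : w \in Lfun PQ 2%:E. Proof. exact: Lfun2_oplus. Qed.
Let mu := Lfun2_measurable uL.
Let mv := Lfun2_measurable vL.
Let mw := Lfun2_measurable wL.
Let I := \int[PQ]_z (w z * w z * \1_S z).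

Let wS : PQ.-integrable setT (EFin \o (fun z => w z * w z * \1_S z)).
Proof.
have wSL : (fun z => w z * \1_S z) \in Lfun PQ 2%:E.
  apply: (Lfun2_le _ wL).
    by apply: measurable_funM => //; exact: measurable_indic.
  apply: nearW => z; rewrite normrM indicE.
  by case: (_ \in _); rewrite ?normr1 ?normr0 ?mulr1 ?mulr0.
by have := Lfun2_mul_integrable wL wSL; under eq_fun do rewrite mulrA.
Qed.

Let A x : \bar R := (\int[Q]_y (w (x, y) * w (x, y) * \1_S (x, y))%:E)%E.
Let A' y : \bar R := (\int[P]_x (w (x, y) * w (x, y) * \1_S (x, y))%:E)%E.
Let Fge0 z : (0 <= (w z * w z * \1_S z)%:E)%E.
Proof. by rewrite lee_fin mulr_ge0// -expr2 sqr_ge0. Qed.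
Let mF : measurable_fun setT (fun z => (w z * w z * \1_S z)%:E).
Proof. exact: measurable_int wS. Qed.
Let mA : measurable_fun setT A.
Proof. exact: (measurable_fun_fubini_tonelli_F (fun z => (w z * w z * \1_S z)%:E)). Qed.
Let mA' : measurable_fun setT A'.
Proof. exact: (measurable_fun_fubini_tonelli_G (fun z => (w z * w z * \1_S z)%:E)). Qed.
Let A0 x : (0 <= A x)%E. Proof. exact: integral_ge0. Qed.
Let A'0 x : (0 <= A' x)%E. Proof. exact: integral_ge0. Qed.
Let AI : (\int[P]_x A x = I%:E)%E.
Proof.
rewrite /I EFin_Rintegral//.
by rewrite (fubini_tonelli1 (fun z => (w z * w z * \1_S z)%:E)).
Qed.
Let A'I : (\int[Q]_x A' x = I%:E)%E.
Proof.
rewrite /I EFin_Rintegral//.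
by rewrite (fubini_tonelli2 (fun z => (w z * w z * \1_S z)%:E)).
Qed.

Let ae_O1 : {ae P, forall x, O1 x}.
Proof. by apply/negligibleP; [exact: measurableC|]. Qed.
Let ae_O2 : {ae Q, forall y, O2 y}.
Proof. by apply/negligibleP; [exact: measurableC|]. Qed.

Let mS1 x : measurable [set y | S (x, y)].
Proof. by rewrite -[X in measurable X]setTI; exact: (pair1_measurable x). Qed.
Let mS2 y : measurable [set x | S (x, y)].
Proof. by rewrite -[X in measurable X]setTI; exact: (pair2_measurable y). Qed.

Lemma sqr_sum_le2 (a b : R) : (a + b) ^+ 2 <= 2 * a ^+ 2 + 2 * b ^+ 2.
Proof.
rewrite -subr_ge0.
have -> : 2 * a ^+ 2 + 2 * b ^+ 2 - (a + b) ^+ 2 = (a - b) ^+ 2 by ring.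
exact: sqr_ge0.
Qed.

Let mx_F x : measurable_fun setT (fun y => (w (x, y) * w (x, y) * \1_S (x, y))%:E).
Proof. exact: measurableT_comp mF (pair1_measurable x). Qed.
Let my_F y : measurable_fun setT (fun x => (w (x, y) * w (x, y) * \1_S (x, y))%:E).
Proof. exact: measurableT_comp mF (pair2_measurable y). Qed.

(** For [x], [z] near each other, [u x - u z = w (x, y) - w (z, y)] for the [y]
    in the overlap of the two sections of [S], which has mass at least [q0]. *)
Lemma near_increment x z : O1 x -> O1 z -> N (x, z) ->
  (q0%:E * ((u x - u z) ^+ 2)%:E <= 2%:E * A x + 2%:E * A z)%E.
Proof.
move=> Ox Oz Nxz; pose D := [set y | S (x, y) /\ S (z, y)].
have mD : measurable D by exact: measurableI (mS1 x) (mS1 z).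
apply: (@le_trans _ _ (Q D * ((u x - u z) ^+ 2)%:E)%E).
  apply: lee_wpmul2r; first by rewrite lee_fin sqr_ge0.
  exact: overlap.
rewrite muleC -(integral_cst Q mD) integral_mkcond.
rewrite -ge0_integralZl//.
rewrite -ge0_integralZl//.
rewrite -ge0_integralD//; first last.
- by apply: emeasurable_funM => //; exact: mx_F.
- by move=> y _; rewrite mule_ge0.
- by apply: emeasurable_funM => //; exact: mx_F.
- by move=> y _; rewrite mule_ge0.
apply: ge0_le_integral => //.
- by move=> y _; rewrite patchE; case: ifP => // _; rewrite lee_fin sqr_ge0.
- exact/(measurable_restrictT _ mD).1/measurable_cst.
- by apply: emeasurable_funD; apply: emeasurable_funM => //; exact: mx_F.
- move=> y _; rewrite patchE; case: ifPn => [|_]; last by rewrite adde_ge0// mule_ge0.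
  rewrite inE => -[Sx Sz]; rewrite -!EFinM -EFinD lee_fin !indicE !mem_set//.
  have -> : u x - u z = w (x, y) + - w (z, y) by rewrite /w /oplus/=; ring.
  by apply: le_trans (sqr_sum_le2 _ _) _; rewrite sqrrN !expr2 !mulr1.
Qed.

(** [I] is the integral of [w ^ 2] over [S], and [A], [A'] its partial integrals. *)
Lemma near_energy :
  (q0%:E * \int[P]_x \int[P]_z ((u x - u z) ^+ 2 * \1_N (x, z))%:E <= (4 * I)%:E)%E.
Proof.
pose F (p : X * X) := ((u p.1 - u p.2) ^+ 2 * \1_N p)%:E.
have mF' : measurable_fun setT F.
  apply/measurable_EFinP; apply: measurable_funM; last exact: measurable_indic.
  apply: measurable_funX; apply: measurable_funB.
    exact: measurableT_comp measurable_fst.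
  exact: measurableT_comp measurable_snd.
have F0 p : (0 <= F p)%E by rewrite lee_fin mulr_ge0// sqr_ge0.
have mFx x : measurable_fun setT (fun z => F (x, z)).
  exact: measurableT_comp mF' (pair1_measurable x).
have mFF : measurable_fun setT (fun x => \int[P]_z F (x, z))%E.
  exact: (measurable_fun_fubini_tonelli_F F).
have I0 : 0 <= I by rewrite -lee_fin -AI; exact: integral_ge0.
have q0E : (0 <= q0%:E)%E by rewrite lee_fin ltW.
have cA x : (0 <= 2%:E * A x)%E by rewrite mule_ge0.
have mcA : measurable_fun setT (fun x => 2%:E * A x)%E.
  exact: emeasurable_funM.
have icA : (\int[P]_x (2%:E * A x) = (2 * I)%:E)%E.
  by rewrite ge0_integralZl// AI.
apply: (@le_trans _ _ (\int[P]_x (2%:E * A x + (2 * I)%:E))%E); last first.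
  rewrite ge0_integralD//; last first.
    by move=> x _; rewrite lee_fin mulr_ge0//.
  by rewrite icA integral_cstT -EFinD -mulrDl lee_fin ler_wpM2r//; lra.
have iF0 x : (0 <= \int[P]_z ((u x - u z) ^+ 2 * \1_N (x, z))%:E)%E.
  by apply: integral_ge0 => z _; exact: (F0 (x, z)).
rewrite -ge0_integralZl//.
apply: ae_ge0_le_integral => //.
- by move=> x _; rewrite mule_ge0.
- exact: emeasurable_funM.
- by move=> x _; rewrite adde_ge0// lee_fin mulr_ge0//.
- exact: emeasurable_funD.
apply: filterS ae_O1 => x Ox _.
rewrite -ge0_integralZl//; last 2 first.
- exact: mFx.
- by move=> z _; exact: (F0 (x, z)).
rewrite -icA -(integral_cstT P (2%:E * A x)%E) -ge0_integralD//.
apply: ae_ge0_le_integral => //.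
- by move=> z _; apply: mule_ge0 => //; exact: (F0 (x, z)).
- by apply: emeasurable_funM => //; exact: mFx.
- by move=> z _; rewrite adde_ge0.
- exact: emeasurable_funD.
apply: filterS ae_O1 => z Oz _.
rewrite /F indicE/=; have [|_] := boolP ((x, z) \in N); last first.
  by rewrite mulr0 mule0 adde_ge0.
by rewrite inE mulr1 => Nxz; exact: near_increment.
Qed.

Let m := \int[P]_x u x.
Let V := \int[P]_x ((u x - m) * (u x - m)).
Let umL : (fun x => u x - m) \in Lfun P 2%:E.
Proof. by apply: Lfun2B => //; exact: Lfun2_cst. Qed.
Let vmL : (fun y => v y + m) \in Lfun Q 2%:E.
Proof. by apply: Lfun2D => //; exact: Lfun2_cst. Qed.
Let um0 : \int[P]_x (u x - m) = 0.
Proof.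
rewrite RintegralB//; last 2 first.
- exact: Lfun2_integrable.
- exact/Lfun2_integrable/Lfun2_cst.
by rewrite Rintegral_cstT subrr.
Qed.

Let VE : V = \int[P]_x ((u x - m) * u x).
Proof.
rewrite /V (@eq_Rintegral _ _ _ _ _ (fun x => (u x - m) * u x - m * (u x - m))); last first.
  by move=> x _; ring.
rewrite RintegralB//; last 2 first.
- exact: Lfun2_mul_integrable.
- exact/rintegrableZ/Lfun2_integrable.
by rewrite RintegralZl ?um0 ?mulr0 ?subr0//; exact: Lfun2_integrable.
Qed.

(** [m] and [V] are the mean and the variance of [u]. *)
Lemma double_variance :
  (\int[P]_x \int[P]_z ((u x - u z) ^+ 2)%:E = (2 * V)%:E)%E.
Proof.
have nuL := Lfun2N uL; have dL := Lfun2_oplus uL nuL.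
pose PP := ((P \x P)%E : probability (X * X)%type R).
have -> : 2 * V = \int[PP]_p (oplus u (fun z => - u z) p * oplus u (fun z => - u z) p).
  rewrite Rintegral_mul_oplus// mulr2n mulrDl mul1r VE; congr (_ + _).
  - apply: eq_Rintegral => x _; congr (_ * _); rewrite /oplus/=.
    rewrite RintegralB//; last 2 first.
    + exact/Lfun2_integrable/Lfun2_cst.
    + exact: Lfun2_integrable.
    by rewrite Rintegral_cstT.
  - apply: eq_Rintegral => x _; rewrite /oplus/=.
    rewrite RintegralB//; last 2 first.
    + exact: Lfun2_integrable.
    + exact/Lfun2_integrable/Lfun2_cst.
    by rewrite Rintegral_cstT -/m; ring.
have dd := Lfun2_mul_integrable dL dL.
rewrite EFin_Rintegral//.
rewrite (fubini_tonelli1 (fun p => (oplus u (fun z => - u z) p * oplus u (fun z => - u z) p)%:E))//.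
- exact: (measurable_int PP dd).
- by move=> p; rewrite lee_fin -expr2 sqr_ge0.
Qed.

Lemma variance_le : V <= 2 * (B / q0) * I.
Proof.
have h : ((2 * V)%:E <= (B * q0^-1 * (4 * I))%:E)%E.
  rewrite -double_variance; apply: le_trans poincare _.
  set J := (\int[P]_x _)%E.
  have -> : ((B * q0^-1 * (4 * I))%:E = (B * q0^-1)%:E * (4 * I)%:E)%E by rewrite EFinM.
  apply: le_trans (lee_wpmul2l _ near_energy).
    by rewrite muleA -EFinM divfK// gt_eqF.
  by rewrite lee_fin divr_ge0 ?(ltW q00)// (le_trans (ltW q00)).
rewrite lee_fin in h; rewrite -(@ler_pM2l _ 2)//.
by apply: le_trans h _; rewrite le_eqVlt; apply/orP; left; apply/eqP; ring.
Qed.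

Let W := \int[Q]_y ((v y + m) * (v y + m)).

(** For fixed [y], the constant [v y + m] equals [w (x, y) - (u x - m)] for every
    [x] in the section of [S], which has mass at least [p0]. *)
Lemma mean_shift_le : p0 * W <= 2 * I + 2 * V.
Proof.
have vv := Lfun2_mul_integrable vmL vmL; have uu := Lfun2_mul_integrable umL umL.
have I0 : 0 <= I by rewrite -lee_fin -AI; exact: integral_ge0.
have V0 : 0 <= V by apply: Rintegral_ge0 => x _; rewrite -expr2 sqr_ge0.
have mA2 : measurable_fun setT (fun y => 2%:E * A' y)%E by exact: emeasurable_funM.
rewrite -lee_fin EFinD !EFinM /W EFin_Rintegral//.
have vv0 y : (0 <= ((v y + m) * (v y + m))%:E)%E by rewrite lee_fin -expr2 sqr_ge0.
rewrite -ge0_integralZl//; last 2 first.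
- exact: (measurable_int Q vv).
- by rewrite lee_fin ltW.
rewrite -A'I -ge0_integralZl//.
rewrite -(integral_cstT Q (2%:E * V%:E)%E) -ge0_integralD//; last first.
  by move=> y _; rewrite mule_ge0.
  by move=> y _; rewrite mule_ge0.
apply: ae_ge0_le_integral => //.
- by move=> y _; rewrite mule_ge0// lee_fin ltW.
- by apply: emeasurable_funM => //; exact: (measurable_int Q vv).
- by move=> y _; rewrite adde_ge0// mule_ge0.
- exact: emeasurable_funD.
apply: filterS ae_O2 => y Oy _.
have mD := mS2 y; set D := [set x | S (x, y)] in mD.
apply: (@le_trans _ _ (P D * ((v y + m) * (v y + m))%:E)%E).
  by apply: lee_wpmul2r => //; exact: thick.
rewrite muleC -(integral_cst P mD) integral_mkcond.
rewrite /V EFin_Rintegral//.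
have uu0 x : (0 <= ((u x - m) * (u x - m))%:E)%E by rewrite lee_fin -expr2 sqr_ge0.
have muu : measurable_fun setT (fun x => ((u x - m) * (u x - m))%:E).
  exact: (measurable_int P uu).
rewrite -ge0_integralZl//.
rewrite -ge0_integralZl//.
rewrite -ge0_integralD//; first last.
- exact: emeasurable_funM.
- by move=> x _; rewrite mule_ge0.
- by apply: emeasurable_funM => //; exact: my_F.
- by move=> x _; rewrite mule_ge0.
apply: ge0_le_integral => //.
- by move=> x _; rewrite patchE; case: ifP => // _; exact: vv0.
- exact/(measurable_restrictT _ mD).1/measurable_cst.
- by apply: emeasurable_funD; apply: emeasurable_funM => //; exact: my_F.
- move=> x _; rewrite patchE; case: ifPn => [|_]; last by rewrite adde_ge0// mule_ge0.
  rewrite inE => Sx; rewrite -!EFinM -EFinD lee_fin indicE mem_set//.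
  have -> : v y + m = w (x, y) + - (u x - m) by rewrite /w /oplus/=; ring.
  by rewrite -!expr2; apply: le_trans (sqr_sum_le2 _ _) _; rewrite sqrrN mulr1.
Qed.

(** Pythagoras for [w = (u - m) (+) (v + m)]. *)
Lemma oplus_sqnorm : \int[PQ]_z (w z * w z) = V + W.
Proof.
have wE : w = oplus (fun x => u x - m) (fun y => v y + m).
  by apply/funext => z; rewrite /w /oplus; ring.
rewrite {2}wE Rintegral_mul_oplus//; congr (_ + _).
- rewrite (@eq_Rintegral _ _ _ _ _ (fun x => (u x - m) * u x + (\int[Q]_y v y) * (u x - m))); last first.
    move=> x _; rewrite /w /oplus/= RintegralD//; last 2 first.
    + exact/Lfun2_integrable/Lfun2_cst.
    + exact: Lfun2_integrable.
    by rewrite Rintegral_cstT; ring.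
  rewrite RintegralD//; last 2 first.
  + exact: Lfun2_mul_integrable.
  + exact/rintegrableZ/Lfun2_integrable.
  by rewrite RintegralZl ?um0 ?mulr0 ?addr0 ?VE//; exact: Lfun2_integrable.
- apply: eq_Rintegral => y _; congr (_ * _); rewrite /w /oplus/= RintegralD//; last 2 first.
  + exact: Lfun2_integrable.
  + exact/Lfun2_integrable/Lfun2_cst.
  by rewrite Rintegral_cstT addrC.
Qed.

(** If the sections of [S] are thick and overlap at neighbouring points, and [u]
    satisfies a nonlocal Poincare inequality at the scale of the neighbourhoods
    [N], then the [L^2] norm of [u (+) v] is controlled by its restriction to
    [S]. *)
Lemma coercivity :
  \int[PQ]_z (w z * w z) <= 8 * (B / q0) / p0 * \int[PQ]_z (w z * w z * \1_S z).
Proof.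
have I0 : 0 <= I by rewrite -lee_fin -AI; exact: integral_ge0.
have hV := variance_le; have hW := mean_shift_le.
have V0 : 0 <= V by apply: Rintegral_ge0 => x _; rewrite -expr2 sqr_ge0.
have K1 : 1 <= B / q0 by rewrite ler_pdivlMr// mul1r.
rewrite -/I oplus_sqnorm mulrAC ler_pdivlMr//.
move: (B / q0) K1 hV => K K1 hV.
have h1 : V * p0 <= V by rewrite ler_piMr.
have h2 : I <= K * I by rewrite ler_peMl.
have h3 : (V + W) * p0 = V * p0 + p0 * W by ring.
have h4 : 8 * K * I = 8 * (K * I) by ring.
have h5 : 2 * K * I = 2 * (K * I) by ring.
rewrite h3 h4; rewrite h5 in hV.
by move: (K * I) h2 hV (V * p0) h1 (p0 * W) hW => a h2 hV b h1 c hW; lra.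
Qed.

End coercivity.

(** * Euclidean norm and support of a measure *)

Section euclidean_norm.
Context {R : realType} {n : nat}.
Implicit Types (x y z : 'rV[R]_n) (A U : set 'rV[R]_n).

Lemma enorm_ge0 x : 0 <= enorm x.
Proof. exact: sqrtr_ge0. Qed.

Lemma enorm0 : enorm (0 : 'rV[R]_n) = 0.
Proof. by rewrite /enorm big1 ?sqrtr0// => i _; rewrite mxE expr0n. Qed.

Lemma enormN x : enorm (- x) = enorm x.
Proof. by congr Num.sqrt; apply: eq_bigr => i _; rewrite mxE sqrrN. Qed.

Lemma coord_le_norm x i : `|x ord0 i| <= `|x|.
Proof.
rewrite [leRHS]mx_normrE.
by rewrite (le_trans _ (@le_bigmax _ _ _ _ (fun ij => `|x ij.1 ij.2|) (ord0, i))).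
Qed.

Lemma enorm_le x : enorm x <= n%:R * `|x|.
Proof.
have h : \sum_(i < n) x ord0 i ^+ 2 <= (n%:R * `|x|) ^+ 2.
  apply: (@le_trans _ _ (\sum_(i < n) `|x| ^+ 2)).
    apply: ler_sum => i _; rewrite -[leLHS]ger0_norm ?sqr_ge0// normrX.
    by rewrite lerXn2r ?nnegrE//; exact: coord_le_norm.
  rewrite sumr_const card_ord exprMn -[leLHS]mulr_natl ler_wpM2r ?sqr_ge0//.
  by rewrite -natrX ler_nat; case: (n) => // k; rewrite leq_pmulr.
by rewrite (le_trans (ler_wsqrtr h))// sqrtr_sqr ger0_norm// mulr_ge0.
Qed.

Lemma measurable_enorm : measurable_fun setT (@enorm R n).
Proof.
apply: measurableT_comp; first exact: (continuous_measurable_fun (@sqrt_continuous R)).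
apply: measurable_sum => i; apply: measurable_funX; exact: measurable_coord_mx.
Qed.

End euclidean_norm.

Section support.
Context {R : realType} {n : nat}.
Implicit Types (mu : probability 'rV[R]_n R) (x y : 'rV[R]_n).

(** A countable base of the topology: sup-norm balls with rational centre and
    radius [1 / (k + 1)]. *)
Definition rat_ball (q : 'rV[rat]_n * nat) : set 'rV[R]_n :=
  ball (map_mx ratr q.1 : 'rV[R]_n) q.2.+1%:R^-1.

Lemma open_rat_ball x (V : set 'rV[R]_n) : open V -> V x ->
  exists q, rat_ball q x /\ rat_ball q `<=` V.
Proof.
move=> oV Vx.
have /nbhs_ballP[e /= e0 eV] : nbhs x V by exact: open_nbhs_nbhs.
have [k ke] : exists k : nat, k.+1%:R^-1 < e / 2.
  exists (Num.truncn (e / 2)^-1).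
  rewrite invf_plt ?posrE ?divr_gt0//; exact: truncnS_gt.
have k0 : 0 < k.+1%:R^-1 :> R by rewrite invr_gt0.
have q_ex (ij : 'I_1 * 'I_n) : exists q : rat, `|x ij.1 ij.2 - ratr q| < k.+1%:R^-1.
  have /rat_in_itvoo[q] : x ij.1 ij.2 - k.+1%:R^-1 < x ij.1 ij.2 + k.+1%:R^-1.
    by rewrite ltrD2l gtrN.
  rewrite in_itv/= => /andP[q1 q2]; exists q.
  by rewrite ltr_distlC q1.
have [F FE] := choice q_ex.
pose q := \matrix_(i, j) F (i, j) : 'rV[rat]_n.
have qx : rat_ball (q, k) x.
  by split => // i j; rewrite /ball/= !mxE distrC; exact: (FE (i, j)).
exists (q, k); split => // y qy; apply: eV.
apply: le_ball (ball_triangle (ball_sym qx) qy).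
by rewrite /= (splitr e) lerD// ltW.
Qed.

Lemma open_rat_ballP q : open (rat_ball q).
Proof. exact: ball_open. Qed.

(** The complement of the support is a countable union of open null sets. *)
Lemma msupportC mu : exists F : nat -> set 'rV[R]_n,
  [/\ forall k, open (F k), forall k, mu (F k) = 0%E &
      ~` msupport mu = \bigcup_k F k].
Proof.
pose F k : set 'rV[R]_n :=
  if unpickle k is Some q then
    (if mu (rat_ball q) == 0%E then rat_ball q else set0) else set0.
exists F; split.
- move=> k; rewrite /F; case: unpickle => [q|]; last exact: open0.
  by case: ifP => _; [exact: open_rat_ballP|exact: open0].
- move=> k; rewrite /F; case: unpickle => [q|]; last exact: measure0.
  by case: ifP => [/eqP//|_]; exact: measure0.
apply/seteqP; split => x /=.
- move=> /existsNP[V /not_implyP[oV /not_implyP[Vx /negP]]].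
  rewrite -leNgt => muV.
  have [q [qx qV]] := open_rat_ball oV Vx.
  exists (pickle q) => //; rewrite /F pickleK ifT//.
  rewrite eq_le measure_ge0 andbT; apply: le_trans muV.
  apply: le_measure => //; rewrite inE; apply: open_measurable_mx => //.
  exact: open_rat_ballP.
- move=> [k _]; rewrite /F; case: unpickle => [q|//]; case: ifP => [/eqP q0 qx|//].
  by move=> /(_ (rat_ball q) (@open_rat_ballP q) qx); rewrite q0 ltxx.
Qed.

Lemma measurable_msupport mu : measurable (msupport mu).
Proof.
have [F [oF _ FE]] := msupportC mu.
rewrite -[msupport mu]setCK FE; apply: measurableC.
by apply: bigcupT_measurable => k; exact: open_measurable_mx.
Qed.

Lemma msupportC_null mu : mu (~` msupport mu) = 0%E.
Proof.
have [F [oF F0 FE]] := msupportC mu.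
have mC := measurableC (measurable_msupport mu).
apply/(negligibleP mu mC).
rewrite FE; apply: negligible_bigcup => k.
have mF : measurable (F k) by exact: open_measurable_mx.
by exists (F k); split => //; exact: F0.
Qed.

Lemma measurable_eball x (r : R) : measurable (eball x r).
Proof.
have mf : measurable_fun setT (fun y => enorm (y - x)).
  apply: measurableT_comp; first exact: measurable_enorm.
  apply: measurable_fun_mxP => // i j; under eq_fun do rewrite !mxE.
  by apply: measurable_funB => //; exact: measurable_coord_mx.
have -> : eball x r = setT `&` (fun y => enorm (y - x)) @^-1` `]-oo, r[.
  by rewrite setTI; apply/seteqP; split => y; rewrite /eball /= in_itv.
exact: mf.
Qed.

Lemma ball_eball x (r e : R) : n%:R * e <= r -> ball x e `<=` [set y | enorm (y - x) <= r].
Proof.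
move=> er y; rewrite mx_norm_ball/ball_/= => xy.
rewrite -enormN opprB (le_trans (enorm_le _))// (le_trans _ er)//.
by rewrite ler_wpM2l// ltW.
Qed.

(** A compact support: locally [mu (eball y r)] is bounded below by the mass of a
    smaller sup-norm ball, and compactness makes the bound uniform. *)
Lemma msupport_ball_inf mu (r : R) : 0 < r -> compact (msupport mu) ->
  msupport mu !=set0 ->
  0 < inf [set fine (mu (eball y r)) | y in msupport mu].
Proof.
move=> r0 cS [y0 Sy0].
(* two points of a sup-norm ball of radius [e] are at Euclidean distance < [r] *)
pose e : R := r / (4 * n.+1%:R).
have n0 : 0 < n.+1%:R :> R by rewrite ltr0n.
have e0 : 0 < e by rewrite divr_gt0// mulr_gt0.
have ner : n%:R * (e + e) < r.
  have nn : n%:R < n.+1%:R :> R by rewrite ltr_nat.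
  have -> : n%:R * (e + e) = n%:R / n.+1%:R * (r / 2).
    by rewrite /e; field; rewrite gt_eqF.
  have : n%:R / n.+1%:R < 1 :> R by rewrite ltr_pdivrMr// mul1r.
  have r20 : 0 < r / 2 by rewrite divr_gt0.
  rewrite -(ltr_pM2r r20) mul1r => /lt_trans; apply.
  by rewrite ltr_pdivrMr// ltr_pMr// ltr1n.
have fin_mu A : measurable A -> mu A = (fine (mu A))%:E.
  by move=> mA; rewrite fineK// fin_num_measure.
have [k hk] : exists k : nat, forall y, msupport mu y ->
    k.+1%:R^-1 <= fine (mu (eball y r)).
  have /compact_near_coveringP/(_ nat \oo) := cS.
  move=> /(_ (fun k y => k.+1%:R^-1 <= fine (mu (eball y r))) _) h.
  suff [k _ hk] : \forall k \near \oo, msupport mu `<=`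
      (fun y => k.+1%:R^-1 <= fine (mu (eball y r))).
    by exists k; apply: (hk k) => /=.
  apply: h => y Sy.
  have my : (0 < mu (ball y e))%E by apply: Sy; [exact: ball_open|exact: ballxx].
  have mb : measurable (ball y e : set 'rV[R]_n).
    by apply: open_measurable_mx; exact: ball_open.
  rewrite (fin_mu _ mb) lte_fin in my.
  exists (ball y e, [set k | k.+1%:R^-1 < fine (mu (ball y e))]) => /=.
    split; first exact: nbhsx_ballx.
    exact: near_infty_natSinv_lt (PosNum my).
  move=> [y' k] /= [yy' hk]; apply: (le_trans (ltW hk)).
  rewrite -lee_fin -fin_mu// -fin_mu; last exact: measurable_eball.
  apply: le_measure; rewrite ?inE//; first exact: measurable_eball.
  move=> z yz; rewrite /eball/=; apply: le_lt_trans ner.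
  have := ball_triangle (ball_sym yy') yz.
  exact: (@ball_eball y' (n%:R * (e + e))).
apply: (@lt_le_trans _ _ k.+1%:R^-1); first by rewrite invr_gt0.
apply: lb_le_inf; first by exists (fine (mu (eball y0 r))), y0.
by move=> _ [y Sy <-]; exact: hk.
Qed.

End support.

(** * Bounded sets and measurability of Lipschitz functions *)

Section bounded_sets.
Context {R : realType} {n : nat}.
Implicit Types (x y z : 'rV[R]_n) (A U : set 'rV[R]_n).

Lemma bounded_set_norm A : bounded_set A -> exists K : R, forall x, A x -> `|x| <= K.
Proof.
by move=> /ex_strict_bound_gt0[K _ AK]; exists K => x Ax; rewrite ltW// AK.
Qed.

Lemma bounded_closure_norm A : bounded_set A ->
  exists K : R, forall x, closure A x -> `|x| <= K.
Proof.
move=> /bounded_set_norm[K AK]; exists (K + 1) => x.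
move=> /(_ (ball x 1) (nbhsx_ballx _ _ ltr01)) [y [Ay]].
rewrite mx_norm_ball/ball_/= => xy.
rewrite -(subrK y x) (le_trans (ler_normD _ _))// addrC lerD//; first exact: AK.
exact: ltW.
Qed.

Lemma enorm_le_ediam A (K : R) : (forall x, A x -> `|x| <= K) ->
  forall x z, A x -> A z -> enorm (x - z) <= ediam A.
Proof.
move=> AK x z Ax Az; apply: ub_le_sup; last by exists (x, z).
exists (n%:R * (K + K)) => _ [[x' z'] /= [Ax' Az'] <-].
rewrite (le_trans (enorm_le _))// ler_wpM2l// (le_trans (ler_normB _ _))//.
by rewrite lerD// AK.
Qed.

Lemma ediam_gt0 U A : (0 < n)%N -> open U -> U !=set0 -> U `<=` A ->
  (forall x z, A x -> A z -> enorm (x - z) <= ediam A) -> 0 < ediam A.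
Proof.
move=> n0 oU [p Up] UA diamA.
have /nbhs_ballP[e /= e0 eU] : nbhs p U by exact: open_nbhs_nbhs.
pose v : 'rV[R]_n := const_mx (e / 2).
have e20 : 0 < e / 2 by rewrite divr_gt0.
have Uv : U (v + p).
  apply: eU; split => // i j; rewrite /ball/= !mxE opprD addrCA subrr addr0.
  by rewrite normrN gtr0_norm// ltr_pdivrMr// ltr_pMr// ltr1n.
apply: lt_le_trans (diamA _ _ (UA _ Uv) (UA _ Up)).
rewrite addrK sqrtr_gt0 (eq_bigr (fun=> (e / 2) ^+ 2)); last by move=> i _; rewrite mxE.
by rewrite sumr_const card_ord pmulrn_lgt0// exprn_gt0.
Qed.

End bounded_sets.

(** Borel measurability for the product sigma-algebra. *)
Lemma measurable_lipschitz {R : realType} {n : nat}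
    (c : 'rV[R]_n * 'rV[R]_n -> R) (L : R) : 0 < L ->
  (forall z z', `|c z - c z'| <=
     L * Num.sqrt (enorm (z.1 - z'.1) ^+ 2 + enorm (z.2 - z'.2) ^+ 2)) ->
  measurable_fun setT c.
Proof.
move=> L0 cL.
(* [c] is a continuous function on ['rV_(n + n)] precomposed with the measurable
   concatenation *)
pose c' (x : 'rV[R]_(n + n)) := c (lsubmx x, rsubmx x).
have -> : c = c' \o (fun z => row_mx z.1 z.2).
  by apply/funext => -[x y]; rewrite /c'/= row_mxKl row_mxKr.
apply: measurableT_comp; last first.
  apply: measurable_fun_mxP => // i j.
  under eq_fun do rewrite mxE.
  case: (fintype.split j) => k.
    exact: (measurableT_comp (measurable_coord_mx i k) measurable_fst).
  exact: (measurableT_comp (measurable_coord_mx i k) measurable_snd).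
have c'L x y : `|c' x - c' y| <= L * ((n + n)%:R * `|x - y|).
  apply: le_trans (cL _ _) _; rewrite ler_pM2l//= -!linearB/=.
  suff -> : Num.sqrt (enorm (lsubmx (x - y)) ^+ 2 + enorm (rsubmx (x - y)) ^+ 2) =
    enorm (x - y) by exact: enorm_le.
  rewrite /enorm !sqr_sqrtr ?sumr_ge0//; try by move=> i _; exact: sqr_ge0.
  rewrite [in RHS]big_split_ord/=; congr (Num.sqrt (_ + _)).
    by apply: eq_bigr => i _; rewrite mxE.
  by apply: eq_bigr => i _; rewrite mxE.
have cc' : continuous c'.
  move=> x; apply/(@cvgrPdist_lt R R^o _ (nbhs x) _ c') => e e0.
  pose k : R := L * (n + n)%:R + 1.
  have k0 : 0 < k by rewrite ltr_wpDl// mulr_ge0// ltW.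
  apply/nbhs_ballP; exists (e / k) => /=; first by rewrite divr_gt0.
  move=> y; rewrite mx_norm_ball/ball_/= => xy.
  apply: le_lt_trans (c'L _ _) _; rewrite mulrA.
  apply: (@le_lt_trans _ _ (k * `|x - y|)).
    by rewrite ler_wpM2r// lerDl.
  by rewrite mulrC -ltr_pdivlMr.
apply: (measurability _ (RGenOpens.measurableE R)) => _ [_ [a [b ->] <-]].
rewrite setTI; apply: open_measurable_mx.
by apply: open_comp; [move=> A _; exact: cc'|exact: interval_open].
Qed.

(** * Contact points and comparison with Lebesgue measure *)

Lemma ae_prod {R : realType} {d1 d2} {X : measurableType d1} {Y : measurableType d2}
    (P : probability X R) (Q : probability Y R) (O1 : set X) (O2 : set Y) :
  measurable O1 -> measurable O2 -> P (~` O1) = 0%E -> Q (~` O2) = 0%E ->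
  {ae (P \x Q)%E, forall z, O1 z.1 /\ O2 z.2}.
Proof.
move=> mO1 mO2 PO1 QO2.
have mC1 := measurableC mO1; have mC2 := measurableC mO2.
exists ((~` O1 `*` setT) `|` (setT `*` ~` O2)); split.
- by apply: measurableU; exact: measurableX.
- have mA : measurable (~` O1 `*` [set: Y]) by exact: measurableX.
  have mB : measurable ([set: X] `*` ~` O2) by exact: measurableX.
  have A0 : (P \x Q)%E (~` O1 `*` [set: Y]) = 0%E.
    by rewrite product_measure1E// [X in (X * _)%E]PO1 mul0e.
  have B0 : (P \x Q)%E ([set: X] `*` ~` O2) = 0%E.
    by rewrite product_measure1E// [X in (_ * X)%E]QO2 mule0.
  apply/eqP; rewrite -measure_le0; apply: le_trans (measureU2 _ mA mB) _.
  by rewrite [X in (X + _)%E]A0 [X in (_ + X)%E]B0 adde0.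
- move=> [x y] /= /not_andP[]; [left|right]; split => //.
Qed.

Lemma lipschitz_bounded {R : realType} {n : nat} (L K : R) (A : set 'rV[R]_n)
    (f : 'rV[R]_n -> R) : 0 <= L -> (forall x, A x -> `|x| <= K) ->
  elipschitz_on L A f -> exists K', forall x, A x -> `|f x| <= K'.
Proof.
move=> L0 AK fL; have [[x0 Ax0]|A0] := pselect (A !=set0); last first.
  by exists 0 => x Ax; exfalso; apply: A0; exists x.
exists (`|f x0| + L * (n%:R * (K + K))) => x Ax.
rewrite -(subrK (f x0) (f x)) (le_trans (ler_normD _ _))// addrC lerD2l.
apply: le_trans (fL _ _ Ax Ax0) _; rewrite ler_wpM2l//.
rewrite (le_trans (enorm_le _))// ler_wpM2l// (le_trans (ler_normB _ _))//.
by rewrite lerD// AK.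
Qed.

(** Strong monotonicity of [t |-> (t)_+] at points [b] with [b >= eps / 2], with a
    modulus that degrades with the size of the displacement. *)
Lemma pos_part_coercive {R : realType} (a b eps M : R) : 0 < eps -> eps <= M ->
  `|a - b| <= M ->
  eps / (2 * M) * ((a - b) * (a - b) * (eps / 2 <= b)%R%:R) <=
  (Num.max a 0 - Num.max b 0) * (a - b).
Proof.
move=> e0 eM abM; have M0 : 0 < M by exact: lt_le_trans eM.
set k := eps / (2 * M).
have k0 : 0 < k by rewrite divr_gt0// mulr_gt0.
have kM : k * M = eps / 2 by rewrite /k; field; exact: lt0r_neq0.
have k1 : k <= 1 / 2.
  by rewrite /k ler_pdivrMr ?mulr_gt0// mulrA divfK// mul1r.
move: abM; rewrite ler_norml => /andP[h1 h2].
case: (leP (eps / 2) b) => hb /=; rewrite !(mulr1, mulr0).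
- have b0 : 0 < b by apply: lt_le_trans hb; rewrite divr_gt0.
  rewrite (max_l (ltW b0)); case: (leP 0 a) => ha.
  + rewrite ler_piMl// -?expr2 ?sqr_ge0//; lra.
  + rewrite sub0r mulNr -mulrN opprB.
    have ab : 0 < b - a by lra.
    have -> : k * ((a - b) * (a - b)) = k * (b - a) * (b - a) by ring.
    rewrite ler_pM2r//; apply: le_trans hb; rewrite -kM ler_pM2l//; lra.
- case: (leP 0 a) => ha; case: (leP 0 b) => hb'.
  + by rewrite -expr2 sqr_ge0.
  + by rewrite subr0 mulr_ge0//; lra.
  + by rewrite sub0r mulNr -mulrN opprB mulr_ge0//; lra.
  + by rewrite subrr mul0r.
Qed.

Section contact.
Context {R : realType} {disp} {T : measurableType disp}.
Variables (mu : probability T R) (O : set T) (s : T -> R) (eps : R).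

(** A function whose positive part has mean [eps] exceeds [15/16 eps] somewhere.
    Any factor below 1 would do; this one leaves room for the loss of 7/16 in [contact_transport]. *)
Lemma contact_point : 0 < eps -> measurable O -> mu (~` O) = 0%E ->
  measurable_fun setT s ->
  \int[mu]_y Num.max (s y) 0 = eps -> exists2 y, O y & 15 / 16 * eps < s y.
Proof.
move=> e0 mO muO ms sE; apply: contrapT => no.
have sle y : O y -> s y <= 15 / 16 * eps.
  by move=> Oy; rewrite leNgt; apply/negP => lt; apply: no; exists y.
have aeO : {ae mu, forall y, O y} by exists (~` O); split => //; exact: measurableC.
pose k := 15 / 16 * eps.
have k0 : 0 <= k by rewrite mulr_ge0 ?divr_ge0// ltW.
have mm : measurable_fun setT (fun y => Num.max (s y) 0) by exact: measurable_maxr.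
have aek : {ae mu, forall y, `|Num.max (s y) 0| <= k}.
  apply: filterS aeO => y Oy; rewrite ger0_norm; last by rewrite le_max lexx orbT.
  by rewrite ge_max k0 andbT sle.
have mL := Lfun2_bounded mm aek.
have : \int[mu]_y Num.max (s y) 0 <= k.
  rewrite -[leRHS](Rintegral_cstT mu); apply: ae_le_Rintegral.
  - exact: Lfun2_integrable.
  - by apply: Lfun2_integrable; exact: Lfun2_cst.
  - by apply: filterS aek => y; apply: le_trans; exact: ler_norm.
by rewrite sE /k; lra.
Qed.

End contact.

Section density.
Context {R : realType} {d : nat}.
Local Notation Rd := ('rV[R]_d).
Local Notation leb := (lebesgue_rV R d).
Variables (P : probability Rd R) (rho : Rd -> R) (O : set Rd) (a b : R).
Hypothesis mO : measurable O.
Hypothesis PO : P (~` O) = 0%E.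
Hypothesis dens : has_lebesgue_density P rho.
Hypothesis a0 : 0 < a.
Hypothesis rhoab : forall x, O x -> a <= rho x <= b.

Lemma integral_density (F : Rd -> \bar R) : (forall x, 0 <= F x)%E ->
  measurable_fun setT F ->
  (\int[P]_x F x = \int[leb]_(x in O) (F x * (rho x)%:E))%E.
Proof.
move=> F0 mF; have [mrho rho0 PE] := dens.
have merho : measurable_fun setT (EFin \o rho) by exact/measurable_EFinP.
have dom : P `<< leb.
  apply/null_content_dominatesP => A mA lA0; rewrite [LHS]PE//.
  by apply: null_set_integral => //; exact: measurable_funTS.
have ae1 : ae_eq leb setT (Radon_Nikodym_SigmaFinite.f P leb) (EFin \o rho).
  apply: integral_ae_eq => //; first exact: Radon_Nikodym_SigmaFinite.f_integrable.
  by move=> A _ mA; rewrite -Radon_Nikodym_SigmaFinite.f_integral// [LHS]PE.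
have mfR := measurable_int _ (Radon_Nikodym_SigmaFinite.f_integrable dom).
have mOC := measurableC mO.
rewrite (@ge0_negligible_integral _ _ _ P setT (~` O) F)//.
rewrite setTD setCK -(Radon_Nikodym_SigmaFinite.change_of_variables dom)//; last first.
  exact: measurable_funTS.
apply: ge0_ae_eq_integral => //.
- apply: emeasurable_funM; exact: measurable_funTS.
- apply: emeasurable_funM; exact: measurable_funTS.
- by move=> x _; apply: mule_ge0 => //; exact: Radon_Nikodym_SigmaFinite.f_ge0.
- by move=> x _; apply: mule_ge0 => //; rewrite lee_fin.
- by apply: filterS ae1 => x /(_ I) -> _.
Qed.

Lemma density_le (F : Rd -> \bar R) : (forall x, 0 <= F x)%E ->
  measurable_fun setT F ->
  (\int[P]_x F x <= b%:E * \int[leb]_(x in O) F x)%E.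
Proof.
move=> F0 mF; have [mrho rho0 PE] := dens.
have merho : measurable_fun setT (EFin \o rho) by exact/measurable_EFinP.
rewrite integral_density//.
have [->|/set0P[x0 Ox0]] := eqVneq O set0; first by rewrite !integral_set0 mule0.
have b0 : 0 <= b by have /andP[_] := rhoab Ox0; exact: le_trans.
rewrite -ge0_integralZl//; last exact: measurable_funTS.
apply: ge0_le_integral => //.
- by move=> x _; apply: mule_ge0 => //; rewrite lee_fin.
- by apply: emeasurable_funM; exact: measurable_funTS.
- by apply: emeasurable_funM => //; exact: measurable_funTS.
- move=> x Ox; rewrite muleC lee_wpmul2r// lee_fin.
  by have /andP[] := rhoab Ox.
Qed.

Lemma density_ge (F : Rd -> \bar R) : (forall x, 0 <= F x)%E ->
  measurable_fun setT F ->
  (a%:E * \int[leb]_(x in O) F x <= \int[P]_x F x)%E.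
Proof.
move=> F0 mF; have [mrho rho0 PE] := dens.
have merho : measurable_fun setT (EFin \o rho) by exact/measurable_EFinP.
rewrite integral_density// -ge0_integralZl//; last 2 first.
- exact: measurable_funTS.
- by rewrite lee_fin ltW.
apply: ge0_le_integral => //.
- by move=> x _; apply: mule_ge0 => //; rewrite lee_fin ltW.
- by apply: emeasurable_funM => //; exact: measurable_funTS.
- by apply: emeasurable_funM; exact: measurable_funTS.
- move=> x Ox; rewrite muleC lee_wpmul2l// lee_fin.
  by have /andP[] := rhoab Ox.
Qed.

Lemma density_measure_ge A : measurable A -> (a%:E * leb (A `&` O) <= P A)%E.
Proof.
move=> mA; have := density_ge (F := EFin \o \1_A).
move=> /(_ (fun x => ltac:(by rewrite lee_fin indicE; case: (_ \in _)))).
rewrite integral_indic// integral_indic// setIT; apply.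
by apply/measurable_EFinP; exact: measurable_indic.
Qed.

Variables (C r : R) (u : Rd -> R).
Hypothesis r0 : 0 < r.
Hypothesis uL : u \in Lfun P 2%:E.
Hypothesis poinC : nonlocal_poincare_constant O C.
Let N : set (Rd * Rd) := [set p | eball p.1 r p.2].

Lemma measurable_near : measurable N.
Proof.
have mf : measurable_fun setT (fun p : Rd * Rd => enorm (p.2 - p.1)).
  apply: measurableT_comp; first exact: measurable_enorm.
  apply: measurable_fun_mxP => // i j; under eq_fun do rewrite !mxE.
  apply: measurable_funB.
    exact: measurableT_comp (measurable_coord_mx i j) measurable_snd.
  exact: measurableT_comp (measurable_coord_mx i j) measurable_fst.
have -> : N = setT `&` (fun p : Rd * Rd => enorm (p.2 - p.1)) @^-1` `]-oo, r[.
  by rewrite setTI; apply/seteqP; split => y; rewrite /N /eball /= in_itv.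
exact: mf.
Qed.

Let G (p : Rd * Rd) : \bar R := ((u p.1 - u p.2) ^+ 2)%:E.
Let GN (p : Rd * Rd) : \bar R := ((u p.1 - u p.2) ^+ 2 * \1_N p)%:E.
Let mu := Lfun2_measurable uL.

Let G0 p : (0 <= G p)%E. Proof. by rewrite lee_fin sqr_ge0. Qed.
Let GN0 p : (0 <= GN p)%E. Proof. by rewrite lee_fin mulr_ge0// sqr_ge0. Qed.
Let mG0 : measurable_fun setT (fun p : Rd * Rd => (u p.1 - u p.2) ^+ 2).
Proof.
apply: measurable_funX; apply: measurable_funB.
  exact: measurableT_comp measurable_fst.
exact: measurableT_comp measurable_snd.
Qed.
Let mG : measurable_fun setT G. Proof. exact/measurable_EFinP. Qed.
Let mGN : measurable_fun setT GN.
Proof.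
apply/measurable_EFinP; apply: measurable_funM => //.
by apply: measurable_indic; exact: measurable_near.
Qed.

Let mP (F : Rd * Rd -> \bar R) : (forall p, 0 <= F p)%E -> measurable_fun setT F ->
  measurable_fun setT (fun x => \int[P]_z F (x, z))%E.
Proof. by move=> F0 mF; exact: (measurable_fun_fubini_tonelli_F F). Qed.

Let mleb (F : Rd * Rd -> \bar R) : (forall p, 0 <= F p)%E -> measurable_fun setT F ->
  measurable_fun setT (fun x => \int[leb]_(z in O) F (x, z))%E.
Proof.
move=> F0 mF.
pose F' p := (F p * (\1_O p.2)%:E)%E.
have -> : (fun x => \int[leb]_(z in O) F (x, z))%E = (fun x => \int[leb]_z F' (x, z))%E.
  apply/funext => x; rewrite integral_mkcond; apply: eq_integral => z _.
  rewrite /F' patchE indicE/=; case: (z \in O); by rewrite ?mule1 ?mule0.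
apply: (measurable_fun_fubini_tonelli_F F').
  apply: emeasurable_funM => //; apply/measurable_EFinP.
  exact: measurableT_comp (measurable_indic mO) measurable_snd.
by move=> p; apply: mule_ge0 => //; rewrite lee_fin indicE; case: (_ \in _).
Qed.

Let m1 (F : Rd * Rd -> \bar R) x : measurable_fun setT F ->
  measurable_fun setT (fun z => F (x, z)).
Proof. by move=> mF; exact: measurableT_comp mF (pair1_measurable x). Qed.

Lemma double_density_le (F : Rd * Rd -> \bar R) : 0 <= b ->
  (forall p, 0 <= F p)%E -> measurable_fun setT F ->
  (\int[P]_x \int[P]_z F (x, z) <=
   (b * b)%:E * \int[leb]_(x in O) \int[leb]_(z in O) F (x, z))%E.
Proof.
move=> b0 F0 mF; rewrite EFinM -muleA.
have iF x : (0 <= \int[leb]_(z in O) F (x, z))%E by apply: integral_ge0.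
apply: (@le_trans _ _ (\int[P]_x (b%:E * \int[leb]_(z in O) F (x, z)))%E).
  apply: ge0_le_integral => //.
  - by move=> x _; apply: integral_ge0.
  - exact: mP.
  - by apply: emeasurable_funM => //; exact: mleb.
  - by move=> x _; apply: density_le => //; exact: m1.
rewrite ge0_integralZl//; last exact: mleb.
by apply: lee_wpmul2l => //; apply: density_le => //; exact: mleb.
Qed.

Lemma double_density_ge (F : Rd * Rd -> \bar R) :
  (forall p, 0 <= F p)%E -> measurable_fun setT F ->
  ((a * a)%:E * \int[leb]_(x in O) \int[leb]_(z in O) F (x, z) <=
   \int[P]_x \int[P]_z F (x, z))%E.
Proof.
move=> F0 mF; rewrite EFinM -muleA.
have a0' : (0 <= a%:E)%E by rewrite lee_fin ltW.
have iF x : (0 <= \int[leb]_(z in O) F (x, z))%E by apply: integral_ge0.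
apply: (@le_trans _ _ (\int[P]_x (a%:E * \int[leb]_(z in O) F (x, z)))%E).
  rewrite ge0_integralZl//; last exact: mleb.
  by apply: lee_wpmul2l => //; apply: density_ge => //; exact: mleb.
apply: ge0_le_integral => //.
- by move=> x _; apply: mule_ge0.
- by apply: emeasurable_funM => //; exact: mleb.
- exact: mP.
- by move=> x _; apply: density_ge => //; exact: m1.
Qed.

(** The nonlocal Poincare inequality transfers from Lebesgue measure to [P] at
    the cost of the squared ratio of the density bounds. *)
Lemma poincare_density : 0 <= b -> 0 < ediam O ->
  (\int[P]_x \int[P]_z ((u x - u z) ^+ 2)%:E <=
   (b ^+ 2 / a ^+ 2 * (C * (Num.ceil (ediam O / r))%:~R ^+ (d + 2)))%:E *
   \int[P]_x \int[P]_z ((u x - u z) ^+ 2 * \1_N (x, z))%:E)%E.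
Proof.
move=> b0 diam0; have [C1 poin] := poinC.
set D := C * _.
have uO : (\int[leb]_(x in O) (u x ^+ 2)%:E < +oo)%E.
  have h1 : measurable_fun setT (fun x => (u x ^+ 2)%:E).
    by apply/measurable_EFinP; exact: measurable_funX.
  have h := @density_ge (fun x => (u x ^+ 2)%:E) (fun x => sqr_ge0 _) h1.
  have uoo : (\int[P]_x (u x ^+ 2)%:E < +oo)%E.
    have /integrableP[_] := Lfun2_integrable_sqr uL.
    by under eq_integral do rewrite /= ger0_norm ?sqr_ge0//.
  rewrite ltey; apply/eqP => oo; have := le_lt_trans h uoo.
  by rewrite oo gt0_muley ?lte_fin// ltxx.
have muO : measurable_fun O u by exact: measurable_funTS.
have h2 := poin r u r0 muO uO.
have D0 : 0 <= D.
  apply: mulr_ge0; first exact: le_trans C1.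
  by rewrite exprn_ge0// (le_trans _ (ceil_ge _))// divr_ge0// ltW.
apply: le_trans (double_density_le b0 G0 mG) _.
apply: (@le_trans _ _ ((b * b)%:E * (D%:E * ((a * a)^-1%:E * \int[P]_x \int[P]_z GN (x, z))))%E).
  apply: lee_wpmul2l; first by rewrite lee_fin mulr_ge0.
  apply: le_trans h2 _.
  apply: lee_wpmul2l => //.
  rewrite lee_pdivlMl ?mulr_gt0//.
  apply: le_trans (double_density_ge GN0 mGN).
  apply: lee_wpmul2l; first by rewrite lee_fin mulr_ge0// ltW.
  rewrite le_eqVlt; apply/orP; left; apply/eqP; apply: eq_integral => x _.
  rewrite integral_mkcondl; apply: eq_integral => z _.
  rewrite patchE /GN indicE /N.
  have -> : (z \in eball x r) = ((x, z) \in [set p | eball p.1 r p.2]) by apply/idP/idP; rewrite !inE.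
  by case: ifP; rewrite ?mulr1 ?mulr0.
rewrite !muleA -!EFinM; apply: lee_wpmul2r.
  by apply: integral_ge0 => x _; apply: integral_ge0 => z _; exact: (GN0 (x, z)).
rewrite lee_fin le_eqVlt; apply/orP; left; apply/eqP; field.
exact: lt0r_neq0.
Qed.

End density.

(** * The quantitative estimates *)

(** Moving both points by [eps / (8 L)] lowers [fs + gs - c] by at most
    [(1 + 1 + 3/2) eps / 8 = 7/16 eps], as [sqrt 2 <= 3/2]. *)
Lemma contact_transport (R : realType) (n : nat) (eps L : R)
    (O1 O2 : set 'rV[R]_n) (fs gs : 'rV[R]_n -> R) (c : 'rV[R]_n * 'rV[R]_n -> R)
    (x z y y' : 'rV[R]_n) : 0 < eps -> 0 < L ->
  (forall z z', `|c z - c z'| <=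
     L * Num.sqrt (enorm (z.1 - z'.1) ^+ 2 + enorm (z.2 - z'.2) ^+ 2)) ->
  elipschitz_on L O1 fs -> elipschitz_on L O2 gs ->
  O1 x -> O1 z -> O2 y -> O2 y' ->
  enorm (z - x) <= eps / (8 * L) -> enorm (y' - y) <= eps / (8 * L) ->
  15 / 16 * eps < fs x + gs y - c (x, y) ->
  eps / 2 <= fs z + gs y' - c (z, y').
Proof.
move=> e0 L0 cL fL gL Ox Oz Oy Oy' zx yy h.
set r := eps / (8 * L) in zx yy.
have Lr : L * r = eps / 8 by rewrite /r; field; exact: lt0r_neq0.
have r0 : 0 < r by rewrite divr_gt0// mulr_gt0.
have h1 : `|fs z - fs x| <= eps / 8.
  by rewrite -Lr; apply: le_trans (fL _ _ Oz Ox) _; rewrite ler_pM2l.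
have h2 : `|gs y' - gs y| <= eps / 8.
  by rewrite -Lr; apply: le_trans (gL _ _ Oy' Oy) _; rewrite ler_pM2l.
have h3 : `|c (z, y') - c (x, y)| <= 3 / 2 * (eps / 8).
  rewrite -Lr mulrCA; apply: le_trans (cL _ _) _; rewrite ler_pM2l//=.
  have r30 : 0 <= 3 / 2 * r by apply: mulr_ge0; [exact: divr_ge0|exact: ltW].
  rewrite -[leRHS](ger0_norm r30) -sqrtr_sqr ler_wsqrtr//.
  have hsq (t : R) : 0 <= t -> t <= r -> t ^+ 2 <= r ^+ 2.
    by move=> t0 tr; rewrite lerXn2r ?nnegrE// ltW.
  have := hsq _ (enorm_ge0 _) zx; have := hsq _ (enorm_ge0 _) yy.
  have -> : (3 / 2 * r) ^+ 2 = 9 / 4 * r ^+ 2 by field.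
  by have := sqr_ge0 r; lra.
move: h1 h2 h3; rewrite !ler_norml => /andP[a1 a2] /andP[b1 b2] /andP[c1 c2].
lra.
Qed.

Theorem theoremB3 (R : realType) (d : nat)
    (eps L lamP LamP deltaOmega COmega : R)
    (U Omega Omega' : set 'rV[R]_d) (P Q : probability 'rV[R]_d R)
    (rho : 'rV[R]_d -> R) (c : 'rV[R]_d * 'rV[R]_d -> R)
    (fs gs : 'rV[R]_d -> R) :
  (1 <= d)%N -> 0 < eps ->
  bounded_lipschitz_domain U -> Omega = closure U -> msupport P = Omega ->
  0 < lamP -> lamP < LamP ->
  has_lebesgue_density P rho ->
  (forall x, Omega x -> lamP <= rho x <= LamP) ->
  msupport Q = Omega' -> compact Omega' ->
  0 < L ->
  (forall z z', `|c z - c z'| <=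
     L * Num.sqrt (enorm (z.1 - z'.1) ^+ 2 + enorm (z.2 - z'.2) ^+ 2)) ->
  density_constant Omega deltaOmega ->
  nonlocal_poincare_constant Omega COmega ->
  maximizer P Q c eps fs gs ->
  elipschitz_on L Omega fs -> elipschitz_on L Omega' gs ->
  (forall x, Omega x -> \int[Q]_y Num.max (fs x + gs y - c (x, y)) 0 = eps) ->
  (forall y, Omega' y -> \int[P]_x Num.max (fs x + gs y - c (x, y)) 0 = eps) ->
  let gam :=
    gamma_tilde eps L lamP LamP deltaOmega COmega Q Omega Omega' in
  forall f g : 'rV[R]_d -> R, Linfty_on Omega f -> Linfty_on Omega' g ->
  let diff := oplus f g \- oplus fs gs in
  let M := Num.max (supnorm_on (Omega `*` Omega') diff) eps in
  let DPhi_norm := L2norm (P \x Q)%E (DPhi P Q c eps (oplus f g)) in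
  let DGam_norm := DGamma_norm P Q c eps f g in
  ((L2norm (P \x Q) diff <= (gam * M)%:E * DPhi_norm)%E /\
   (((gam * M)^-1)%:E * (QOT P Q c eps - (Phi P Q c eps (oplus f g))%:E)
      <= DPhi_norm ^+ 2)%E) /\
  ((L2norm (P \x Q) diff <= (gam * M)%:E * DGam_norm)%E /\
   (((gam * M)^-1)%:E * (QOT P Q c eps - (Gamma P Q c eps f g)%:E)
      <= DGam_norm ^+ 2)%E).
Proof.
move=> d1 e0 [oU U0 _ bU _] OmegaE supP lam0 lamLam dens rhoB supQ cO' L0 cL.
move=> [/andP[delta0 delta1] dense] poin [fsL gsL _] fsLip gsLip marg1 marg2.
move=> gam f g [mf [Kf fK]] [mg [Kg gK]] diff M.
have mO : measurable Omega by rewrite -supP; exact: measurable_msupport.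
have mO' : measurable Omega' by rewrite -supQ; exact: measurable_msupport.
have PO : P (~` Omega) = 0%E by rewrite -supP; exact: msupportC_null.
have QO' : Q (~` Omega') = 0%E by rewrite -supQ; exact: msupportC_null.
have aeO : {ae P, forall x, Omega x} by exists (~` Omega); split => //; exact: measurableC.
have aeO' : {ae Q, forall y, Omega' y} by exists (~` Omega'); split => //; exact: measurableC.
have aeOO' := ae_prod mO mO' PO QO'.
have mass1 (mu : probability 'rV[R]_d R) A : measurable A -> mu (~` A) = 0%E -> mu A = 1%E.
  move=> mA A0; have := probability_setC mu mA; rewrite A0 => /eqP h.
  by apply/eqP; move: h; rewrite eq_sym sube_eq ?fin_num_measure// add0e eq_sym.
have [KO OK] : exists K, forall x, Omega x -> `|x| <= K.
  by rewrite OmegaE; exact: bounded_closure_norm.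
have [KO' O'K] := bounded_set_norm (compact_bounded cO').
have O'0 : Omega' !=set0.
  apply/set0P/eqP => O0; have := mass1 Q _ mO' QO'; rewrite O0 measure0.
  by move=> /eqP; rewrite eqe eq_sym oner_eq0.
have diamO := enorm_le_ediam OK.
have diam0 : 0 < ediam Omega.
  have UO : U `<=` Omega by rewrite OmegaE; exact: subset_closure.
  exact: (ediam_gt0 d1 oU U0 UO diamO).
have mc := measurable_lipschitz L0 cL.
pose PQ := ((P \x Q)%E : probability ('rV[R]_d * 'rV[R]_d)%type R).
have cL2 : c \in Lfun PQ 2%:E.
  pose K := L * Num.sqrt ((d%:R * KO) ^+ 2 + (d%:R * KO') ^+ 2).
  apply: (@Lfun2_bounded _ _ _ PQ c (`|c (0, 0)| + K)) => //.
  apply: filterS aeOO' => -[x y] /= [Ox Oy].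
  rewrite -(subrK (c (0, 0)) (c (x, y))) (le_trans (ler_normD _ _))// addrC lerD2l.
  apply: le_trans (cL _ _) _; rewrite /K ler_pM2l// ler_wsqrtr//= !subr0.
  have sq (t s : R) : 0 <= t -> t <= s -> t ^+ 2 <= s ^+ 2.
    by move=> t0 ts; rewrite lerXn2r ?nnegrE//; exact: le_trans ts.
  apply: lerD; apply: sq; rewrite ?enorm_ge0//; apply: le_trans (enorm_le _) _.
    by rewrite ler_wpM2l// OK.
  by rewrite ler_wpM2l// O'K.
have fL2 : f \in Lfun P 2%:E.
  by apply: (Lfun2_bounded (K := Kf) mf); apply: filterS aeO => x; exact: fK.
have gL2 : g \in Lfun Q 2%:E.
  by apply: (Lfun2_bounded (K := Kg) mg); apply: filterS aeO' => x; exact: gK.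
have mfs := Lfun2_measurable fsL; have mgs := Lfun2_measurable gsL.
have ms1 x : measurable_fun setT (fun y => fs x + gs y - c (x, y)).
  apply: measurable_funB; first exact: measurable_funD.
  exact: measurableT_comp mc (pair1_measurable x).
have ms2 y : measurable_fun setT (fun x => fs x + gs y - c (x, y)).
  apply: measurable_funB; first exact: measurable_funD.
  exact: measurableT_comp mc (pair2_measurable y).
(* [S]: the points where the optimal slack is at least [eps / 2] *)
pose r := eps / (8 * L).
have r0 : 0 < r by rewrite divr_gt0// mulr_gt0.
pose S := [set z : 'rV[R]_d * 'rV[R]_d | eps / 2 <= fs z.1 + gs z.2 - c z].
have mS : measurable S.
  have mh : measurable_fun setT (fun z : 'rV[R]_d * 'rV[R]_d => fs z.1 + gs z.2 - c z).
    apply: measurable_funB => //; apply: measurable_funD.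
      exact: measurableT_comp mfs measurable_fst.
    exact: measurableT_comp mgs measurable_snd.
  have -> : S = setT `&` (fun z => fs z.1 + gs z.2 - c z) @^-1` `[eps / 2, +oo[.
    by rewrite setTI; apply/seteqP; split => z; rewrite /S /= in_itv/= andbT.
  exact: mh.
pose q0 := inf [set fine (Q (eball y r)) | y in Omega'].
have q00 : 0 < q0.
  have := @msupport_ball_inf R d Q r r0; rewrite supQ => h.
  exact: h.
have q0lb y : Omega' y -> (q0%:E <= Q (eball y r))%E.
  move=> Oy; have mb : measurable (eball y r) by exact: measurable_eball.
  rewrite -[leRHS]fineK ?fin_num_measure// lee_fin; apply: ge_inf; last by exists y.
  by exists 0 => _ [z _ <-]; exact: fine_ge0.
have q01 : q0 <= 1.
  have [y Oy] := O'0; rewrite -lee_fin; apply: le_trans (q0lb y Oy) _.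
  by apply: probability_le1; exact: measurable_eball.
have near0 (x : 'rV[R]_d) : enorm (x - x) <= r by rewrite subrr enorm0 ltW.
have overlap x z : Omega x -> Omega z -> eball x r z ->
    (q0%:E <= Q [set y | S (x, y) /\ S (z, y)])%E.
  move=> Ox Oz xz.
  have [y Oy hy] := contact_point e0 mO' QO' (ms1 x) (marg1 x Ox).
  have mE : measurable [set y | S (x, y) /\ S (z, y)].
    have mSx w : measurable [set y | S (w, y)].
      by rewrite -[X in measurable X]setTI; exact: (pair1_measurable w).
    exact: measurableI (mSx x) (mSx z).
  have mB := measurable_eball y r.
  apply: le_trans (q0lb y Oy) _.
  have -> : Q (eball y r) = Q (eball y r `&` Omega').
    rewrite -[in LHS](setIT (eball y r)) -(setUv Omega') setIUr measureU//; last 3 first.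
    - exact: measurableI.
    - by apply: measurableI => //; exact: measurableC.
    - by rewrite setIACA setICr setI0.
    rewrite [X in (_ + X)%E](_ : _ = 0%E) ?adde0//.
    apply/eqP; rewrite -measure_le0 -QO'; apply: le_measure; rewrite ?inE//.
    - by apply: measurableI => //; exact: measurableC.
    - exact: measurableC.
  apply: le_measure; rewrite ?inE//; first exact: measurableI.
  move=> y' [yy' Oy']; split; rewrite /S/=.
  - exact: (contact_transport e0 L0 cL fsLip gsLip Ox Ox Oy Oy' (near0 x) (ltW yy') hy).
  - exact: (contact_transport e0 L0 cL fsLip gsLip Ox Oz Oy Oy' (ltW xz) (ltW yy') hy).
pose deltaP := Num.min 1 (lamP * deltaOmega).
have deltaP0 : 0 < deltaP by rewrite lt_min ltr01 mulr_gt0.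
pose mx := Num.max (8 * L / eps) 1.
have mx1 : 1 <= mx by rewrite le_max lexx orbT.
have mx0 : 0 < mx by exact: lt_le_trans mx1.
pose p0 := (deltaP^-1 * mx ^+ d)^-1.
have p0E : p0 = deltaP * (mx ^+ d)^-1 by rewrite /p0 invfM invrK.
have p00 : 0 < p0 by rewrite p0E mulr_gt0// invr_gt0 exprn_gt0.
have imx1 : (mx ^+ d)^-1 <= 1 by rewrite invf_le1 ?exprn_gt0// exprn_ege1.
have p01 : p0 <= 1.
  rewrite p0E (le_trans (_ : _ <= deltaP * 1))//; first by rewrite ler_pM2l.
  by rewrite mulr1 ge_min lexx.
have thick y : Omega' y -> (p0%:E <= P [set x | S (x, y)])%E.
  move=> Oy.
  have [x0 Ox0 hx] := contact_point e0 mO PO (ms2 y) (marg2 y Oy).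
  have mA : measurable [set x | S (x, y)].
    by rewrite -[X in measurable X]setTI; exact: (pair2_measurable y).
  have sub x : Omega x -> enorm (x - x0) <= r -> S (x, y).
    move=> Ox xx0.
    exact: (contact_transport e0 L0 cL fsLip gsLip Ox0 Ox Oy Oy xx0 (near0 y) hx).
  have [rdiam|diamr] := leP r (ediam Omega); last first.
    apply: (@le_trans _ _ (P Omega)).
      by rewrite mass1// lee_fin.
    apply: le_measure; rewrite ?inE// => x Ox; apply: sub => //.
    exact: le_trans (diamO _ _ Ox Ox0) (ltW diamr).
  apply: le_trans (density_measure_ge mO PO dens lam0 rhoB mA).
  have h := dense x0 r Ox0; rewrite r0 rdiam in h.
  apply: (@le_trans _ _ (lamP%:E * (deltaOmega * r ^+ d)%:E)%E).
    rewrite -EFinM lee_fin mulrA p0E; apply: ler_pM.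
    - exact: ltW.
    - by rewrite invr_ge0 exprn_ge0// ltW.
    - by rewrite ge_min lexx orbT.
    - rewrite -exprVn lerXn2r ?nnegrE ?invr_ge0 ?(ltW mx0) ?(ltW r0)//.
      rewrite invf_ple ?posrE// le_max; apply/orP; left.
      by rewrite /r invf_div.
  apply: lee_wpmul2l; first by rewrite lee_fin ltW.
  apply: le_trans (h isT) _; apply: le_measure; rewrite ?inE.
  - by apply: measurableI => //; exact: measurable_eball.
  - exact: measurableI.
  - by move=> x [xx0 Ox]; split => //; apply: sub => //; exact: ltW.
pose D := COmega * (Num.ceil (ediam Omega / r))%:~R ^+ (d + 2).
pose B := LamP ^+ 2 / lamP ^+ 2 * D.
have Lam0 : 0 < LamP by exact: lt_trans lamLam.
have C1 : 1 <= COmega by have [] := poin.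
have D1 : 1 <= D.
  rewrite /D -[leLHS]mulr1; apply: ler_pM => //.
  apply: exprn_ege1; rewrite ler1z -gtz0_ge1 ceil_gt0; exact: divr_gt0.
have BD : 1 <= B.
  rewrite /B -[leLHS]mulr1; apply: ler_pM => //.
  rewrite ler_pdivlMr ?exprn_gt0// mul1r lerXn2r ?nnegrE ?ltW//.
have Bq : q0 <= B by exact: le_trans BD.
pose u x := f x - fs x; pose v y := g y - gs y.
have uL : u \in Lfun P 2%:E by exact: Lfun2B.
have vL : v \in Lfun Q 2%:E by exact: Lfun2B.
have diffE : diff = oplus u v.
  by apply/funext => z; rewrite /diff /oplus /u /v/=; ring.
have diffL : diff \in Lfun PQ 2%:E by rewrite diffE; exact: Lfun2_oplus.
have poinP := poincare_density mO PO dens lam0 rhoB r0 uL poin (ltW Lam0) diam0.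
have coer := coercivity mO mO' PO QO' mS (@measurable_near R d r) p00 p01 q00 Bq
  overlap thick uL vL poinP.
rewrite -diffE in coer.
(* the factor 16 is 8 from [coercivity] and 2 from [pos_part_coercive] *)
have gamE : gam = 2 * (8 * (B / q0) / p0).
  rewrite /gam /gamma_tilde -/r -/q0 -/deltaP -/mx /p0 invrK /B /D.
  have -> : 8 * L * ediam Omega / eps = ediam Omega / r.
    by rewrite /r invf_div; ring.
  by ring.
have gam0 : 0 < gam.
  have B0 : 0 < B by exact: lt_le_trans BD.
  rewrite gamE; apply: mulr_gt0 => //; apply: divr_gt0 => //.
  by apply: mulr_gt0 => //; exact: divr_gt0.
have eM : eps <= M by rewrite le_max lexx orbT.
have M0 : 0 < M by exact: lt_le_trans eM.
have [Kfs fsK] := lipschitz_bounded (ltW L0) OK fsLip.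
have [Kgs gsK] := lipschitz_bounded (ltW L0) O'K gsLip.
have diffM z : Omega z.1 -> Omega' z.2 -> `|diff z| <= M.
  move=> Oz1 Oz2; rewrite /M le_max; apply/orP; left.
  apply: ub_le_sup; last by exists z.
  exists (Kf + Kfs + (Kg + Kgs)) => _ [[x y] [/= Ox Oy] <-].
  rewrite diffE /oplus /u /v/= (le_trans (ler_normD _ _))//.
  by apply: lerD; rewrite (le_trans (ler_normB _ _))// lerD//;
    [exact: fK|exact: fsK|exact: gK|exact: gsK].
apply: (gradient_dominance e0 cL2 fsL gsL _ _ fL2 gL2).
- by apply: filterS aeO => x; exact: marg1.
- by apply: filterS aeO' => y; exact: marg2.
- exact: mulr_gt0.
have mm1 : {ae P, forall x, \int[Q]_y slack c (oplus fs gs) (x, y) = eps}.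
  by apply: filterS aeO => x; exact: marg1.
have mm2 : {ae Q, forall y, \int[P]_x slack c (oplus fs gs) (x, y) = eps}.
  by apply: filterS aeO' => y; exact: marg2.
rewrite (score_diff e0 cL2 fsL gsL mm1 mm2 fL2 gL2) -/diff.
have hL := Lfun2_oplus fL2 gL2; have hsL := Lfun2_oplus fsL gsL.
have sdL := Lfun2B (Lfun2_slack cL2 hL) (Lfun2_slack cL2 hsL).
have iS : PQ.-integrable setT (EFin \o (fun z => diff z * diff z * \1_S z)).
  have dSL : (fun z => diff z * \1_S z) \in Lfun PQ 2%:E.
    apply: (Lfun2_le _ diffL).
      by apply: measurable_funM; [exact: Lfun2_measurable diffL|exact: measurable_indic].
    apply: nearW => z; rewrite normrM indicE.
    by case: (_ \in _); rewrite ?normr1 ?normr0 ?mulr1 ?mulr0.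
  by have := Lfun2_mul_integrable diffL dSL; under eq_fun do rewrite mulrA.
have key : eps / (2 * M) * \int[PQ]_z (diff z * diff z * \1_S z) <=
    \int[PQ]_z ((slack c (oplus f g) z - slack c (oplus fs gs) z) * diff z).
  rewrite -RintegralZl//; apply: ae_le_Rintegral.
  - exact: rintegrableZ.
  - exact: Lfun2_mul_integrable.
  - apply: filterS aeOO' => z [Oz1 Oz2].
    have := diffM z Oz1 Oz2.
    have dz : diff z = (oplus f g z - c z) - (oplus fs gs z - c z).
      by rewrite /diff/=; ring.
    rewrite dz => /(pos_part_coercive e0 eM); rewrite indicE.
    suff -> : (z \in S) = (eps / 2 <= oplus fs gs z - c z) by [].
    by apply/idP/idP; rewrite inE.
apply: le_trans coer _.
apply: le_trans (_ : _ <= gam * M * eps^-1 * (eps / (2 * M) * \int[PQ]_z (diff z * diff z * \1_S z))) _.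
  rewrite le_eqVlt; apply/orP; left; apply/eqP; rewrite gamE; field.
  by rewrite !lt0r_neq0.
rewrite [leRHS]mulrA; apply: ler_wpM2l => //.
by apply: mulr_ge0; [apply: mulr_ge0; exact: ltW|rewrite invr_ge0 ltW].
Qed.
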